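(* Let $R$ be a semiprime ring with a derivation $d$, and let $n\geq 1$ be a fixed integer. Suppose that $(d(xy))^n=(d(x))^n(d(y))^n$ for all $x,y\in R$. Let $C$ be the extended centroid of $R$, let $A=O(R)$ be the orthogonal completion of $R$, and let $B=B(C)$ be the Boolean ring of idempotents of $C$. Then there exists an idempotent $e\in B$ such that $eA$ is a commutative ring and $d$ induces the zero derivation on $(1-e)A$ (that is, the unique extension of $d$ to $A$ vanishes on $(1-e)A$).
   Context: Rings are associative (not assumed to have an identity element). A derivation of a ring $R$ is an additive map $d:R\to R$ with $d(xy)=d(x)y+xd(y)$ for all $x,y\in R$. For a semiprime ring $R$, $Q$ denotes the two-sided (symmetric) Martindale quotient ring of $R$: the ring with identity containing $R$ as a subring, unique up to isomorphism over $R$, such that (i) for each $q\in Q$ there is a two-sided ideal $J$ of $R$ with zero annihilator in $R$ such that $qJ\cup Jq\subseteq R$; (ii) if $q\in Q$ and $J$ is a two-sided ideal of $R$ with zero annihilator in $R$, then $qJ=0$ or $Jq=0$ implies $q=0$; (iii) whenever $J$ is a two-sided ideal of $R$ with zero annihilator in $R$, $f:J\to R$ is a right $R$-module map and $g:J\to R$ is a left $R$-module map with $g(x)y=xf(y)$ for all $x,y\in J$, there is $q\in Q$ with $f(x)=qx$ and $g(x)=xq$ for all $x\in J$. The extended centroid $C$ of $R$ is the center of $Q$. $B=B(C)$ is the set of all idempotents of $C$, a Boolean ring under the multiplication of $C$ and the addition $e\oplus f=e+f-2ef$. A subset $U\subseteq B$ is orthogonal if $uv=0$ for all distinct $u,v\in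 U$, and dense if $c\in C$ and $cU=0$ imply $c=0$. A subset $T\subseteq Q$ is orthogonally complete if $0\in T$ and, for every dense orthogonal subset $U\subseteq B$ and every family $(t_u)_{u\in U}$ of elements of $T$, there is $t\in T$ with $ut=ut_u$ for all $u\in U$. The orthogonal completion $O(R)$ is the intersection of all orthogonally complete subsets of $Q$ containing $R$; it is a subring of $Q$. Every derivation $d$ of $R$ extends uniquely to a derivation of $Q$, also denoted $d$; this extension satisfies $d(O(R))\subseteq O(R)$ and $d(e)=0$ for all $e\in B$, so it restricts to a derivation of $A=O(R)$ and of $(1-e)A$ for each $e\in B$. *)

(* Defs.v *)
From HB Require Import structures.
From mathcomp Require Import all_boot ssralg boolp classical_sets.

Set Implicit Arguments.
Unset Strict Implicit.
Unset Printing Implicit Defensive.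

Import GRing.Theory.
Local Open Scope classical_set_scope.
Local Open Scope ring_scope.

(* Associative rings without an identity requirement; the library's ring
   structures are all unital (pzRingType allows 1 = 0). *)
HB.mixin Record Zmodule_isRng R of GRing.Zmodule R := {
  rmul : R -> R -> R;
  rmulA : associative rmul;
  rmulDl : left_distributive rmul +%R;
  rmulDr : right_distributive rmul +%R
}.

#[short(type="rngType")]
HB.structure Definition Rng := {R of GRing.Zmodule R & Zmodule_isRng R}.

Notation "x ** y" := (rmul x y) (at level 40, left associativity) : ring_scope.

(* x ^ n for n >= 1; the value at n = 0 is the junk value 0. *)
Definition rpow (R : rngType) (x : R) (n : nat) : R := iterop n rmul x 0.

Definition semiprime (R : rngType) : Prop :=
  forall a : R, (forall x : R, a ** x ** a = 0) -> a = 0.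

(* The multiplication is a parameter so that the definition serves both for a
   rngType and for a unital ring. *)
Definition derivation (V : zmodType) (mul : V -> V -> V) (d : V -> V) : Prop :=
  (forall x y, d (x + y) = d x + d y) /\
  (forall x y, d (mul x y) = mul (d x) y + mul x (d y)).

Section Martindale.
Variable R : rngType.

Definition ideal (J : set R) : Prop :=
  [/\ J 0, (forall x y, J x -> J y -> J (x - y)),
      (forall r x, J x -> J (r ** x)) & (forall x r, J x -> J (x ** r))].

(* For ideals of a semiprime ring the left and the right annihilator coincide,
   so asking both to vanish is the same as asking it of either. *)
Definition zero_annihilator (J : set R) : Prop :=
  (forall a, (forall x, J x -> a ** x = 0) -> a = 0) /\
  (forall a, (forall x, J x -> x ** a = 0) -> a = 0).

Definition dense_ideal (J : set R) : Prop := ideal J /\ zero_annihilator J.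

(* Module maps out of J are represented by functions on R whose values outside
   J are irrelevant. *)
Definition right_module_map (J : set R) (f : R -> R) : Prop :=
  (forall x y, J x -> J y -> f (x + y) = f x + f y) /\
  (forall x r, J x -> f (x ** r) = f x ** r).

Definition left_module_map (J : set R) (g : R -> R) : Prop :=
  (forall x y, J x -> J y -> g (x + y) = g x + g y) /\
  (forall r x, J x -> g (r ** x) = r ** g x).

Variables (Q : pzRingType) (iota : R -> Q).

(* Q, with the embedding iota, is the symmetric Martindale quotient ring of R;
   these properties determine (Q, iota) up to a unique isomorphism over R. *)
Record symmetric_martindale_quotient : Prop := {
  smq_add : forall x y, iota (x + y) = iota x + iota y;
  smq_mul : forall x y, iota (x ** y) = iota x * iota y;
  smq_inj : injective iota;
  smq_fraction : forall q : Q, exists2 J, dense_ideal J &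
    forall x, J x -> range iota (q * iota x) /\ range iota (iota x * q);
  smq_faithful : forall (q : Q) J, dense_ideal J ->
    (forall x, J x -> q * iota x = 0) \/ (forall x, J x -> iota x * q = 0) ->
    q = 0;
  smq_complete : forall J (f g : R -> R), dense_ideal J ->
    right_module_map J f -> left_module_map J g ->
    (forall x y, J x -> J y -> g x ** y = x ** f y) ->
    exists q : Q, forall x, J x ->
      iota (f x) = q * iota x /\ iota (g x) = iota x * q
}.

End Martindale.

Section OrthogonalCompletion.
Variable Q : pzRingType.

(* For Q the symmetric Martindale quotient ring of R, this is the extended
   centroid of R. *)
Definition center : set Q := [set c | forall q, c * q = q * c].

Definition central_idempotents : set Q := [set e | center e /\ e * e = e].

Definition orthogonal (U : set Q) : Prop :=
  forall u v, U u -> U v -> u <> v -> u * v = 0.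

Definition dense (U : set Q) : Prop :=
  forall c, center c -> (forall u, U u -> c * u = 0) -> c = 0.

Definition orthogonally_complete (T : set Q) : Prop :=
  T 0 /\
  forall U : set Q, U `<=` central_idempotents -> orthogonal U -> dense U ->
  forall t : Q -> Q, (forall u, U u -> T (t u)) ->
  exists2 s, T s & forall u, U u -> u * s = u * t u.

Definition orthogonal_completion (R : rngType) (iota : R -> Q) : set Q :=
  smallest orthogonally_complete (range iota).

End OrthogonalCompletion.

(* A derivation of R has exactly one extension to Q, so a statement about every
   derivation of Q extending d is a statement about the extension of d. *)
Lemma derivation_extension (R : rngType) (Q : pzRingType) (iota : R -> Q)
    (d : R -> R) :
  symmetric_martindale_quotient iota -> derivation rmul d ->
  exists! delta : Q -> Q,
    derivation *%R delta /\ forall x, delta (iota x) = iota (d x).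
Proof.
move=> hQ [dD dM].
have [iD iM iI hfr hfa hco] := hQ.
have r0 (x : R) : x ** 0 = 0.
  by apply: (addrI (x ** 0)); rewrite -rmulDr !addr0.
have l0 (x : R) : 0 ** x = 0.
  by apply: (addrI (0 ** x)); rewrite -rmulDl !addr0.
have i0 : iota 0 = 0 by apply: (addrI (iota 0)); rewrite -iD !addr0.
have iN x : iota (- x) = - iota x.
  by apply: (addrI (iota x)); rewrite -iD !subrr.
have iB x y : iota (x - y) = iota x - iota y by rewrite iD iN.
have d0 : d 0 = 0 by apply: (addrI (d 0)); rewrite -dD !addr0.
have dN x : d (- x) = - d x.
  by apply: (addrI (d x)); rewrite -dD !subrr.
have dI (J K : set R) : dense_ideal J -> dense_ideal K -> dense_ideal (J `&` K).
  move=> [[J0 JB Jl Jr] [Ja Jb]] [[K0 KB Kl Kr] [Ka Kb]].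
  split; first split => //.
  - by move=> x y [? ?] [? ?]; split; [apply: (JB)|apply: (KB)].
  - by move=> r x [? ?]; split; [apply: (Jl)|apply: (Kl)].
  - by move=> x r [? ?]; split; [apply: (Jr)|apply: (Kr)].
  split=> a h.
  - apply: (Ja) => x Jx; apply: (Ka) => y Ky.
    by rewrite -rmulA; apply: (h); split; [apply: (Jr)|apply: (Kl)].
  - apply: (Jb) => x Jx; apply: (Kb) => y Ky.
    by rewrite rmulA; apply: (h); split; [apply: (Jl)|apply: (Kr)].
have dd (J : set R) : dense_ideal J -> dense_ideal [set x | J x /\ J (d x)].
  move=> [[J0 JB Jl Jr] [Ja Jb]].
  have JD x y : J x -> J y -> J (x + y).
    move=> Jx Jy; rewrite -[y]opprK; apply: (JB) => //.
    by rewrite -[- y]add0r; apply: (JB).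
  split; first split => /=.
  - by rewrite d0.
  - by move=> x y [? ?] [? ?]; rewrite dD dN; split; apply: (JB).
  - by move=> r x [? ?]; rewrite dM; split; [apply: (Jl)|apply: (JD); apply: (Jl)].
  - by move=> x r [? ?]; rewrite dM; split; [apply: (Jr)|apply: (JD); apply: (Jr)].
  have Jxy x y : J x -> J y -> J (x ** y) /\ J (d (x ** y)).
    by move=> Jx Jy; rewrite dM; split; [apply: (Jl)|apply: (JD); [apply: (Jl)|apply: (Jr)]].
  split=> a h.
  - by apply: (Ja) => x Jx; apply: (Ja) => y Jy; rewrite -rmulA; apply: (h); apply: Jxy.
  - by apply: (Jb) => x Jx; apply: (Jb) => y Jy; rewrite rmulA; apply: (h); apply: Jxy.
(* p is the value at q of the extension *)
pose P (q p : Q) := exists2 J, dense_ideal J & forall x, J x ->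
  exists2 y, q * iota x = iota y & p * iota x = iota (d y) - q * iota (d x).
have Pex q : exists p, P q p.
  have [J dJ hJ] := hfr q.
  have /choice[F hF] x : exists y, J x -> q * iota x = iota y.
    by have [/hJ[[y _ <-] _]|] := pselect (J x); [exists y|exists 0].
  have /choice[G hG] x : exists y, J x -> iota x * q = iota y.
    by have [/hJ[_ [y _ <-]]|] := pselect (J x); [exists y|exists 0].
  have [[J0 JB Jl Jr] _] := dJ.
  have [[K0 KB Kl Kr] _] := dd _ dJ.
  have JD x y : J x -> J y -> J (x + y).
    move=> Jx Jy; rewrite -[y]opprK; apply: (JB) => //.
    by rewrite -[- y]add0r; apply: (JB).
  have FD x y : J x -> J y -> F (x + y) = F x + F y.
    by move=> Jx Jy; apply: iI; rewrite iD -!hF ?iD ?mulrDr//; apply: (JD).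
  have GD x y : J x -> J y -> G (x + y) = G x + G y.
    by move=> Jx Jy; apply: iI; rewrite iD -!hG ?iD ?mulrDl//; apply: (JD).
  have FM x r : J x -> F (x ** r) = F x ** r.
    by move=> Jx; apply: iI; rewrite iM -!hF ?iM ?mulrA//; apply: (Jr).
  have GM x r : J x -> G (r ** x) = r ** G x.
    by move=> Jx; apply: iI; rewrite iM -!hG ?iM ?mulrA//; apply: (Jl).
  have GF x y : J x -> J y -> G x ** y = x ** F y.
    by move=> Jx Jy; apply: iI; rewrite !iM -hF// -hG// mulrA.
  have NM (x y : R) : (- x) ** y = - (x ** y).
    by apply: (addrI (x ** y)); rewrite -rmulDl !subrr l0.
  have MN (x y : R) : x ** (- y) = - (x ** y).
    by apply: (addrI (x ** y)); rewrite -rmulDr !subrr r0.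
  have := hco _ (fun x => d (F x) - F (d x)) (fun x => d (G x) - G (d x)) (dd _ dJ).
  case.
  - split=> [x y [Jx Jdx] [Jy Jdy]|x r [Jx Jdx]].
      by rewrite FD// !dD FD// opprD addrACA.
    rewrite FM// !dM FD ?FM//; try by [apply: (Jr)].
    by rewrite rmulDl NM opprD addrACA subrr addr0.
  - split=> [x y [Jx Jdx] [Jy Jdy]|r x [Jx Jdx]].
      by rewrite GD// !dD GD// opprD addrACA.
    rewrite GM// !dM GD ?GM//; try by [apply: (Jl)].
    by rewrite rmulDr MN opprD addrACA subrr add0r.
  - move=> x y [Jx Jdx] [Jy Jdy].
    rewrite rmulDl rmulDr NM MN !GF//.
    have := dM (G x) y; rewrite GF// dM GF// => h.
    by apply/eqP; rewrite subr_eq addrAC eq_sym subr_eq -h addrC.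
  move=> p hp; exists p; exists [set x | J x /\ J (d x)]; first exact: dd.
  move=> x Kx; exists (F x); first by rewrite hF//; case: Kx.
  by rewrite -(hp x Kx).1 iB hF//; case: Kx.
have Pun q p p' : P q p -> P q p' -> p = p'.
  move=> [J dJ hJ] [K dK hK]; apply/eqP; rewrite -subr_eq0; apply/eqP.
  apply: (hfa _ (J `&` K)); first exact: dI.
  left=> x [/hJ[y ey hy] /hK[z ez hz]].
  have yz : y = z by apply: iI; rewrite -ey -ez.
  by rewrite mulrBl hy hz yz subrr.
have P_ext (D : Q -> Q) q : derivation *%R D ->
    (forall x, D (iota x) = iota (d x)) -> P q (D q).
  move=> [_ DM] De; have [J dJ hJ] := hfr q.
  exists J => // x /hJ[[y _ ey] _]; exists y => //.
  by rewrite -De ey DM De addrK.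
have /choice[D hD] := Pex.
have De x : D (iota x) = iota (d x).
  apply: (Pun (iota x)) => //; have [J dJ _] := hfr 0.
  by exists J => // y _; exists (x ** y); rewrite -?iM// dM iD !iM addrK.
exists D; split; last first.
  move=> D' [dD' De']; apply/funext => q; apply: (Pun q) => //.
  exact: P_ext.
split=> //; split.
- move=> q q'; apply: (Pun (q + q')) => //.
  have [J dJ hJ] := hD q; have [K dK hK] := hD q'.
  exists (J `&` K); first exact: dI.
  move=> x [/hJ[y ey hy] /hK[z ez hz]]; exists (y + z).
    by rewrite mulrDl ey ez iD.
  by rewrite mulrDl hy hz dD iD mulrDl opprD addrACA.
- move=> q q'; apply/eqP; rewrite -subr_eq0; apply/eqP.
  have [J dJ hJ] := hD q; have [K dK hK] := hD q'.
  have [M dM' hM] := hD (q * q').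
  have dKM := dI _ _ dK dM'; apply: (hfa _ _ dKM); left=> x KMx.
  apply: (hfa _ _ dJ); left=> y Jy.
  have [[Kx Mx] Jxr] : (K `&` M) x /\ forall r, (K `&` M) (x ** r).
    by split=> // r; case: dKM => -[_ _ _ +] _; apply.
  have [z ez hz] := hK _ Kx.
  have [Kxy Mxy] := Jxr y.
  have Jzy : J (z ** y) by case: dJ => -[_ _ + _] _; apply.
  have [w ew hw] := hJ _ Jzy.
  have [z' ez' hz'] := hK _ Kxy.
  have [w' ew' hw'] := hM _ Mxy.
  have zz : z' = z ** y by apply: iI; rewrite -ez' !iM mulrA ez.
  have ww : w' = w by apply: iI; rewrite -ew' -ew -zz -ez' mulrA.
  rewrite -mulrA -iM mulrBl hw' mulrDl -[D q * q' * _]mulrA ez' zz hw ww.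
  by rewrite -[q * D q' * _]mulrA hz' zz mulrBr !mulrA addrA subrK subrr.
Qed.

(* Main.v *)
Require Import Defs.
From HB Require Import structures.
From mathcomp Require Import all_boot all_algebra boolp classical_sets functions.

(** The power condition forces [d = 0], and then [e = 0] does: the extension of
[d] to [Q] vanishes, because every [q] in [Q] carries a dense ideal into [R].
Below, [f x] stands for [d(x) ^ n], so that [f] is multiplicative, and [x']
for [d x].

Passing to a module.  Suppose [a = d x0] is nonzero.  By Levitzki's theorem
([levitzki]) the nilpotency indices in [R a] are unbounded, so in the rng [S]
of sequences in [R] some [b] in the ideal of the constant sequence [a] is not
nilpotent.  Hence [1 - b X] generates a proper left ideal of polynomials over
the unitization of [S], and a maximal left ideal above it gives a simple module
[V] on which [b], and therefore [a], does not act as zero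
([simple_module_exists]).  The identity [f (x y) = f x f y] holds in [S], but
there is no reason for it to hold for polynomials: in characteristic
[p <= n] it need not survive an extension of scalars.  So [V] is kept as a
module over [S] with the commuting operator [X].  A maximal commutative set [K]
of endomorphisms commuting with both is a field, equal to its own centralizer,
and the [K]-span of the image of [S] acts densely on the [K]-space [V]
([density]).  It remains to show that [d] acts as zero on such a module
([derivation_zero_on_dense_module]).

Zero products.  Modulo the kernel of the action, which is a semiprime
ideal, [x y = 0] implies [x y' = x' y = 0] ([mul_zero_derivation]).  For
[x^2 = 0] and [z = x r x] one has [z^2 = 0], so [z'] is nilpotent of bounded
index, while [x z'^m = (x x' r)^m x]; Levitzki's theorem then gives [x x' = 0].

Finite rank.  The full linearization of the identity extends to the
[K]-span of the pairs [(x, x')] ([multilinear_identity]).  If the second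
components could be prescribed freely on [2n] vectors killed by the first ones,
a chain of [2n] steps would violate it ([no_free_family]).  By density the only
obstruction is that [x' = [T, x]] for a linear [T] which is a scalar plus an
operator of finite rank, so every [x'] has finite rank
([derivation_finrank]).

A constant.  Let [c] have minimal positive rank.  The operators [c s] on the
image of [c] form a domain spanning a full matrix algebra, and such a domain
contains a nonzero scalar ([scalar_in_order]).  This gives [e = c r] with
[e^2 = a e] for a scalar [a].  Zero products yield [e e' = e' e = a e'], hence
[(e^k)' = k a^(k-1) e'].  Comparing [f (e^k)] with [f(e)^k] for [k = 2, 3] shows
that [e' = 0] or that [3^n = 4^n] in [K]; either way some power [g] of [e] has
[g' = 0] and [g <> 0] ([constant_scaled_idempotent]).  Now [f (x g) = 0], that
is [(x' g)^n = 0], and minimality of the rank gives [g x' g = 0]; a last zero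
product removes the left factor [g], and primeness the right one. *)

Set Implicit Arguments.
Unset Strict Implicit.
Unset Printing Implicit Defensive.

Import GRing.Theory.
Local Open Scope classical_set_scope.
Local Open Scope ring_scope.

(** * Levitzki's theorem modulo a semiprime kernel *)
Section RngMorphisms.
Variables (R : rngType) (E : pzRingType).

Definition rng_morphism (rho : R -> E) : Prop :=
  (forall x y, rho (x + y) = rho x + rho y) /\
  (forall x y, rho (x ** y) = rho x * rho y).

(** The semiprime quotient of [R] that occurs is never formed: it is the image
of [rho], and statements about it are equations in [E]. *)
Definition semiprime_kernel (rho : R -> E) : Prop :=
  forall a, (forall x, rho a * rho x * rho a = 0) -> rho a = 0.

Variable rho : R -> E.
Hypothesis rhoM : rng_morphism rho.

Lemma rngD x y : rho (x + y) = rho x + rho y. Proof. by case: rhoM. Qed.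
Lemma rngM x y : rho (x ** y) = rho x * rho y. Proof. by case: rhoM. Qed.
Lemma rng0 : rho 0 = 0.
Proof. by apply: (addrI (rho 0)); rewrite -rngD !addr0. Qed.
Lemma rngN x : rho (- x) = - rho x.
Proof. by apply: (addrI (rho x)); rewrite -rngD !subrr rng0. Qed.
Lemma rngB x y : rho (x - y) = rho x - rho y.
Proof. by rewrite rngD rngN. Qed.

Lemma rpowS (x : R) m : rpow x m.+2 = x ** rpow x m.+1.
Proof. by []. Qed.

Lemma rng_pow x n : (0 < n)%N -> rho (rpow x n) = rho x ^+ n.
Proof.
case: n => // n _; elim: n => [|n IHn]; first by rewrite expr1.
by rewrite rpowS rngM IHn [in RHS]exprS.
Qed.

End RngMorphisms.

Section Levitzki.
Variables (R : rngType) (E : pzRingType) (rho : R -> E).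
Hypotheses (rhoM : rng_morphism rho) (rho_sp : semiprime_kernel rho).

(** Only the words in which no [b] stands directly before a [c] survive. *)
Lemma exprD_ann (A : pzRingType) (b c : A) m : b * c = 0 ->
  (b + c) ^+ m = \sum_(i < m.+1) c ^+ i * b ^+ (m - i).
Proof.
move=> bc; elim: m => [|m IHm]; first by rewrite big_ord1 !expr0 mulr1.
rewrite exprS IHm mulrDl big_ord_recl [in RHS]big_ord_recl !expr0 !mul1r !subn0.
rewrite exprS mulrDr mulr_sumr big1 => [|i _]; last first.
  by rewrite /= exprS !mulrA bc !mul0r.
rewrite addr0; congr (_ + _).
rewrite -[b ^+ m]mul1r -[1](expr0 c) -[in b ^+ m](subn0 m).
rewrite -(big_ord_recl m (fun i : 'I_m.+1 => c ^+ i * b ^+ (m - i))) mulr_sumr.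
by apply: eq_bigr => i _; rewrite /= /bump /= add1n exprS mulrA subSS.
Qed.

(** Induction on [m].  Put [b = a r] and [w = b^(m+1) a]; since [b w = 0], the
words surviving in [(b + w s)^(m+2) a = 0] are [(w s)^i b^(m+2-i) a], and
multiplying by [(w s)^m] on the left leaves [(w s)^(m+1) w = 0].  So [w]
satisfies the hypothesis with exponent one less, hence [w = 0], and then so
does [a]. *)
Lemma levitzki m (a : R) :
  (forall r, (rho a * rho r) ^+ m * rho a = 0) -> rho a = 0.
Proof.
elim: m a => [|[|m] IHm] a ha.
- by have := ha a; rewrite expr0 mul1r.
- by apply: rho_sp => r; have := ha r; rewrite expr1.
apply: (IHm) => r.
set u := rho a; set b := u * rho r.
have ub k : exists x, b ^+ k * u = u * x.
  elim: k => [|k [x hx]]; first by exists 1; rewrite expr0 mul1r mulr1.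
  by exists (rho r * u * x); rewrite exprS -mulrA hx /b !mulrA.
have rb k : exists x, b ^+ k * u = rho x.
  elim: k => [|k [x hx]]; first by exists a; rewrite expr0 mul1r.
  by exists (a ** r ** x); rewrite exprS -mulrA hx !(rngM rhoM).
have [w hw] := rb m.+1; have [w' hw'] := rb m.
rewrite hw; apply: IHm => s; rewrite -hw.
set c := _ * rho s.
have cE : c = u * rho (r ** w' ** s).
  by rewrite !(rngM rhoM) -hw' /c exprS /b !mulrA.
have cu : c ^+ m.+2 * u = 0 by rewrite cE; apply: ha.
have bc : b * c = 0.
  by rewrite /c !mulrA -exprS ha mul0r.
(* [c] must be opaque, lest its powers be unfolded by the ring lemmas. *)
clearbody c.
have := ha (r + r ** w' ** s).
rewrite (rngD rhoM) mulrDr -/u -/b -cE (exprD_ann _ bc) mulr_suml.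
move=> /(congr1 (fun z => c ^+ m * z)); rewrite mulr0 mulr_sumr.
rewrite big_ord_recl big_ord_recl big1 => [|i _]; last first.
  rewrite (_ : nat_of_ord (lift ord0 (lift ord0 i)) = i.+2)%N //.
  have [x hx] := ub (m.+2 - i.+2)%N.
  rewrite -[c ^+ i.+2 * _ * u]mulrA hx.
  rewrite mulrA -exprD mulrA addnC -[i.+2]addn2 -addnA add2n exprD.
  by rewrite -[_ * u]mulrA cu mulr0 mul0r.
rewrite expr0 mul1r subn0 ha mulr0 add0r addr0 (_ : nat_of_ord (lift _ _) = 1)%N //.
rewrite subSS subn0.
by rewrite expr1 !mulrA -exprSr.
Qed.

End Levitzki.

(** * Zero products and the derivation *)
Section ZeroProducts.
Variables (R : rngType) (d : R -> R) (E : pzRingType) (rho : R -> E) (n : nat).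
Hypotheses (rhoM : rng_morphism rho) (rho_sp : semiprime_kernel rho).
Hypotheses (dD : derivation rmul d) (n_gt0 : (0 < n)%N).
Hypothesis dn : forall x y,
  rho (d (x ** y)) ^+ n = rho (d x) ^+ n * rho (d y) ^+ n.

Local Notation D x := (rho (d x)).

Lemma rho_dD x y : D (x + y) = D x + D y.
Proof. by case: dD => h _; rewrite h (rngD rhoM). Qed.

Lemma rho_dM x y : D (x ** y) = D x * rho y + rho x * D y.
Proof. by case: dD => _ h; rewrite h (rngD rhoM) !(rngM rhoM). Qed.

(** For [x] in the kernel, [d (x y)] agrees with [d(x) y]; so [d] of the kernel
is an ideal modulo the kernel, and [f (x y x y) = f (x y)^2] makes it nil of
bounded index. *)
Lemma kernel_derivation x : rho x = 0 -> D x = 0.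
Proof.
move=> x0; apply: (levitzki rhoM rho_sp (m := n + n)) => y.
have xy : D (x ** y) = D x * rho y by rewrite rho_dM x0 mul0r addr0.
have := dn (x ** y) (x ** y).
rewrite [D (_ ** (_ ** _))]rho_dM (rngM rhoM) x0 mul0r mulr0 mul0r addr0.
by rewrite expr0n gtn_eqF // -exprD xy => <-; rewrite mul0r.
Qed.

(** With [z = x r x], the relation [z^2 = 0] makes [z'] nilpotent of index at
most [2n], and [x z'^m = (x x' r)^m x]. *)
Lemma square_zero_derivation x : rho x * rho x = 0 -> rho x * D x = 0.
Proof.
move=> xx.
have S0 : D (x ** x) = 0 by apply: kernel_derivation; rewrite (rngM rhoM).
rewrite -(rngM rhoM); apply: (levitzki rhoM rho_sp (m := n + n)) => r.
rewrite (rngM rhoM).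
set z := x ** r ** x.
have zz : rho (z ** z) = 0.
  by rewrite !(rngM rhoM) !mulrA -[_ * rho x * rho x]mulrA xx mulr0 !mul0r.
have z'n : D z ^+ (n + n) = 0.
  by rewrite exprD -dn (kernel_derivation zz) expr0n gtn_eqF.
have xz' : rho x * D z = rho x * D x * rho r * rho x.
  rewrite /z !rho_dM !(rngM rhoM) mulrDr !mulrDl mulrDr !mulrA xx !mul0r.
  by rewrite !addr0.
have xz'm m : rho x * D z ^+ m = (rho x * D x * rho r) ^+ m * rho x.
  elim: m => [|m IHm]; first by rewrite !expr0 mul1r mulr1.
  by rewrite exprS mulrA xz' -mulrA IHm mulrA -exprS.
by rewrite mulrA -xz'm z'n mulr0 mul0r.
Qed.

(** Apply the case of square zero to [y r x].  For [s = x y' = - x' y] the outcome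
is [y r s r x = 0], and multiplying by [x'] and [y'] turns it into
[(s r)^2 s = 0]. *)
Lemma mul_zero_derivation x y : rho x * rho y = 0 ->
  rho x * D y = 0 /\ D x * rho y = 0.
Proof.
move=> xy.
have S0 : D x * rho y + rho x * D y = 0.
  by rewrite -rho_dM; apply: kernel_derivation; rewrite (rngM rhoM).
suff S1 : rho x * D y = 0 by split=> //; move: S0; rewrite S1 addr0.
have SN : D x * rho y = - (rho x * D y) by apply/eqP; rewrite -addr_eq0 S0.
have [_ dM] := dD.
rewrite -[D y]/(rho (d y)) -(rngM rhoM).
apply: (levitzki rhoM rho_sp (m := 2)) => r; rewrite (rngM rhoM).
have : rho (y ** r ** x) * D (y ** r ** x) = 0.
  apply: square_zero_derivation.
  by rewrite !(rngM rhoM) !mulrA -[_ * rho x * rho y]mulrA xy mulr0 !mul0r.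
rewrite !rho_dM !(rngM rhoM) !mulrDl !mulrDr !mulrA.
rewrite -!(mulrA _ (rho x) (rho y)) xy !mulr0 !mul0r !addr0.
move=> /(congr1 (fun z => D x * z * D y)); rewrite mulr0 mul0r.
rewrite !mulrA SN !mulNr => /eqP; rewrite oppr_eq0 => /eqP.
by rewrite expr2 !mulrA.
Qed.

End ZeroProducts.

(** * The ring of additive endomorphisms *)
Record endo (V : zmodType) := Endo {
  endo_fun :> V -> V;
  endoD : forall u v, endo_fun (u + v) = endo_fun u + endo_fun v
}.

HB.instance Definition _ (V : zmodType) := gen_eqMixin (endo V).
HB.instance Definition _ (V : zmodType) := gen_choiceMixin (endo V).

Section Endomorphisms.
Variable V : zmodType.
Implicit Types f g h : endo V.

Lemma endoP f g : (forall v, f v = g v) -> f = g.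
Proof.
case: f g => [f fD] [g gD] /= /funext fg; case: _ / fg gD => gD.
by congr Endo; apply: Prop_irrelevance.
Qed.

Lemma endo0 f : f 0 = 0.
Proof. by apply: (addrI (f 0)); rewrite -endoD !addr0. Qed.

Lemma endoN f v : f (- v) = - f v.
Proof. by apply: (addrI (f v)); rewrite -endoD !subrr endo0. Qed.

Lemma endoB f u v : f (u - v) = f u - f v.
Proof. by rewrite endoD endoN. Qed.

Lemma endo_sumr f (I : Type) (s : seq I) (P : pred I) (F : I -> V) :
  f (\sum_(i <- s | P i) F i) = \sum_(i <- s | P i) f (F i).
Proof. exact: (big_morph f (endoD f) (endo0 f)). Qed.

Definition endo_zero : endo V := @Endo V (fun=> 0) (fun _ _ => esym (addr0 0)).
Fact endo_opp_subproof f u v : - f (u + v) = - f u - f v.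
Proof. by rewrite endoD opprD. Qed.
Definition endo_opp f : endo V := Endo (endo_opp_subproof f).
Fact endo_add_subproof f g u v : f (u + v) + g (u + v) = f u + g u + (f v + g v).
Proof. by rewrite !endoD addrACA. Qed.
Definition endo_add f g : endo V := Endo (endo_add_subproof f g).
Definition endo_one : endo V := @Endo V id (fun _ _ => erefl).
Fact endo_mul_subproof f g u v : f (g (u + v)) = f (g u) + f (g v).
Proof. by rewrite !endoD. Qed.
Definition endo_mul f g : endo V := Endo (endo_mul_subproof f g).

Fact endo_addA : associative endo_add.
Proof. by move=> f g h; apply: endoP => v /=; rewrite addrA. Qed.
Fact endo_addC : commutative endo_add.
Proof. by move=> f g; apply: endoP => v /=; rewrite addrC. Qed.
Fact endo_add0 : left_id endo_zero endo_add.
Proof. by move=> f; apply: endoP => v /=; rewrite add0r. Qed.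
Fact endo_addN : left_inverse endo_zero endo_opp endo_add.
Proof. by move=> f; apply: endoP => v /=; rewrite addNr. Qed.

HB.instance Definition _ :=
  GRing.isZmodule.Build (endo V) endo_addA endo_addC endo_add0 endo_addN.

Fact endo_mulA : associative endo_mul. Proof. by move=> f g h; apply: endoP. Qed.
Fact endo_mul1 : left_id endo_one endo_mul. Proof. by move=> f; apply: endoP. Qed.
Fact endo_mulr1 : right_id endo_one endo_mul. Proof. by move=> f; apply: endoP. Qed.
Fact endo_mulDl : left_distributive endo_mul +%R.
Proof. by move=> f g h; apply: endoP. Qed.
Fact endo_mulDr : right_distributive endo_mul +%R.
Proof. by move=> f g h; apply: endoP => v /=; rewrite endoD. Qed.

HB.instance Definition _ := GRing.Zmodule_isPzRing.Build (endo V)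
  endo_mulA endo_mul1 endo_mulr1 endo_mulDl endo_mulDr.

Lemma endo_addE f g v : (f + g) v = f v + g v. Proof. by []. Qed.
Lemma endo_oppE f v : (- f) v = - f v. Proof. by []. Qed.
Lemma endo_subE f g v : (f - g) v = f v - g v. Proof. by []. Qed.
Lemma endo_mulE f g v : (f * g) v = f (g v). Proof. by []. Qed.
Lemma endo_oneE v : (1 : endo V) v = v. Proof. by []. Qed.
Lemma endo_zeroE v : (0 : endo V) v = 0. Proof. by []. Qed.

Lemma endo_suml (I : Type) (s : seq I) (P : pred I) (F : I -> endo V) v :
  (\sum_(i <- s | P i) F i) v = \sum_(i <- s | P i) F i v.
Proof. by apply: (big_morph (fun f : endo V => f v)). Qed.

End Endomorphisms.

(** * Linearization *)
Section Polarization.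
Variables (R : zmodType) (E : pzRingType).

(** Inclusion-exclusion: the tuple [g] contributes once for each set [S]
containing its values, with signs that cancel unless [g] is onto, that is,
injective.  It holds in any characteristic, and is applied with all the [L i]
equal and with the [L i] depending on a second family. *)
Lemma polarization n (L : 'I_n -> R -> E) (x : 'I_n -> R) :
  (forall i u v, L i (u + v) = L i u + L i v) ->
  \sum_(S : {set 'I_n}) (-1) ^+ #|~: S| * \prod_(i < n) L i (\sum_(j in S) x j) =
  \sum_(g : {ffun 'I_n -> 'I_n} | injectiveb g) \prod_(i < n) L i (x (g i)).
Proof.
move=> LD.
have L0 i : L i 0 = 0 by apply: (addrI (L i 0)); rewrite -LD !addr0.
have LS i (S : {set 'I_n}) : L i (\sum_(j in S) x j) = \sum_(j in S) L i (x j).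
  exact: (big_morph (L i) (LD i) (L0 i)).
pose F (g : {ffun 'I_n -> 'I_n}) := \prod_(i < n) L i (x (g i)).
transitivity (\sum_(S : {set 'I_n}) \sum_(g in ffun_on S) (-1) ^+ #|~: S| * F g).
  apply: eq_bigr => S _.
  rewrite -mulr_sumr; congr (_ * _).
  rewrite (eq_bigr (fun i => \sum_(j in S) L i (x j))) => [|i _]; last exact: LS.
  by rewrite (bigA_distr_big).
rewrite (exchange_big_dep xpredT) //= [RHS]big_mkcond /=; apply: eq_bigr => g _.
rewrite -mulr_suml; case: ifPn => [/injectiveP g_inj|].
  have gS (S : {set 'I_n}) : (g \in ffun_on (mem S)) = (S == finset.setT).
    apply/ffun_onP/eqP => [gS|-> i]; last by rewrite inE.
    apply/setP => j; rewrite inE.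
    by have [h _ hK] := injF_bij g_inj; rewrite -(hK j); apply: gS.
  suff -> : \sum_(S : {set 'I_n} | g \in ffun_on (mem S)) (-1) ^+ #|~: S|%SET =
    1 :> E.
    by rewrite mul1r.
  transitivity (\sum_(S : {set 'I_n} | S == finset.setT) (-1) ^+ #|~: S|%SET : E).
    by apply: eq_bigl => S; rewrite gS.
  by rewrite big_pred1_eq finset.setCT cards0 expr0.
move=> g_ninj.
(* The sets containing the missed value [j0] cancel against those without it. *)
have [j0 j0g] : exists j0, j0 \notin codom g.
  apply/existsP; apply: contraR g_ninj; rewrite negb_exists => /forallP gc.
  have /image_injP gi : #|[seq g x | x in 'I_n]| == #|'I_n|.
    by apply/eqP/eq_card => k; have := gc k; rewrite negbK => kg; rewrite !inE;
      exact: kg.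
  by apply/injectiveP => i j; apply: gi.
have gS (S : {set 'I_n}) : (g \in ffun_on (mem (j0 |: S)%SET)) = (g \in ffun_on
  (mem (S :\ j0)%SET)).
  apply/ffun_onP/ffun_onP => gS i; have := gS i; rewrite !inE.
    by case: eqP => //= e; case/negP: j0g; rewrite -e codom_f.
  by case/andP=> _ ->; rewrite orbT.
rewrite (bigID (fun S : {set 'I_n} => j0 \in S)) /=.
rewrite (reindex_onto (fun S : {set 'I_n} => j0 |: S)%SET
                      (fun S : {set 'I_n} => S :\ j0)%SET) /=; last first.
  by move=> S /andP[_ j0S]; rewrite finset.setD1K.
rewrite [X in X + _](_ : _ = - \sum_(S : {set 'I_n} | (g \in ffun_on (mem S))
  && (j0 \notin S)) (-1) ^+ #|~: S|%SET) ?addNr ?mul0r //.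
rewrite -sumrN; apply: eq_big => S.
  rewrite setU11 andbT; have [j0S|j0S] := boolP (j0 \in S).
    rewrite !andbF; apply: negbTE; apply/nandP; right.
    by apply/eqP => /setP/(_ j0); rewrite !inE eqxx /= j0S.
  have SD : (S :\ j0 = S)%SET.
    by apply/setP => k; rewrite !inE; case: eqP => // ->; rewrite (negbTE j0S).
  by rewrite setU1K // eqxx !andbT gS SD.
case/andP => /andP[_ _] /eqP SD; have j0S : j0 \notin S by rewrite -SD !inE eqxx.
have -> : #|~: S|%SET = #|~: (j0 |: S)|%SET.+1.
  rewrite (cardsD1 j0 (~: S)%SET) inE j0S add1n; congr _.+1; apply: eq_card => k.
  by rewrite !inE negb_or.
by rewrite exprS mulN1r opprK.
Qed.
End Polarization.

Section KLinear.
Variables (K : fieldType) (V : lmodType K).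

Definition scalar_endo (k : K) : endo V := Endo (scalerDr k).

Definition klin (x : endo V) : Prop := forall k v, x (k *: v) = k *: x v.

Lemma klin0 : klin 0. Proof. by move=> k v; rewrite !endo_zeroE scaler0. Qed.
Lemma klin1 : klin 1. Proof. by []. Qed.
Lemma klinD x y : klin x -> klin y -> klin (x + y).
Proof. by move=> hx hy k v; rewrite !endo_addE hx hy scalerDr. Qed.
Lemma klinN x : klin x -> klin (- x).
Proof. by move=> hx k v; rewrite !endo_oppE hx scalerN. Qed.
Lemma klinM x y : klin x -> klin y -> klin (x * y).
Proof. by move=> hx hy k v; rewrite !endo_mulE hy hx. Qed.
Lemma klin_scalar k : klin (scalar_endo k).
Proof. by move=> l v; rewrite /= !scalerA mulrC. Qed.
Lemma klin_comm k x : klin x -> x * scalar_endo k = scalar_endo k * x.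
Proof. by move=> hx; apply: endoP => v; rewrite !endo_mulE hx. Qed.
Lemma klin_prod (I : eqType) (s : seq I) (F : I -> endo V) :
  {in s, forall i, klin (F i)} -> klin (\prod_(i <- s) F i).
Proof.
elim: s => [_|a s IHs hs]; first by rewrite big_nil.
rewrite big_cons; apply: klinM; first by apply: hs; rewrite mem_head.
by apply: IHs => i si; apply: hs; rewrite in_cons si orbT.
Qed.

Lemma prod_slotD (A : pzRingType) (I : eqType) (s : seq I) (i0 : I)
    (F G H : I -> A) :
  uniq s -> i0 \in s -> F i0 = G i0 + H i0 ->
  (forall i, i != i0 -> F i = G i) -> (forall i, i != i0 -> F i = H i) ->
  \prod_(i <- s) F i = \prod_(i <- s) G i + \prod_(i <- s) H i.
Proof.
move=> + + F0 FG FH; elim: s => // a s IHs; rewrite in_cons /= !big_cons.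
case/andP=> na us /orP[/eqP e|si].
  subst a.
  have E : {in s, forall i, F i = G i /\ F i = H i}.
    by move=> i si; split; [apply: FG|apply: FH]; apply: contraNneq na => <-.
  rewrite F0 mulrDl; congr (_ * _ + _ * _); apply: eq_big_seq => i /E[] //.
have ai : a != i0 by apply: contraNneq na => ->.
by rewrite IHs // mulrDr {1}FG // FH.
Qed.

Lemma prod_slotZ (I : eqType) (s : seq I) (i0 : I) (k : K)
    (F G : I -> endo V) :
  uniq s -> i0 \in s -> F i0 = scalar_endo k * G i0 ->
  (forall i, i != i0 -> F i = G i) -> (forall i, klin (G i)) ->
  \prod_(i <- s) F i = scalar_endo k * \prod_(i <- s) G i.
Proof.
move=> + + F0 FG hG; elim: s => // a s IHs; rewrite in_cons /= !big_cons.
case/andP=> na us /orP[/eqP e|si].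
  subst a; rewrite F0 -mulrA; congr (_ * (_ * _)).
  by apply: eq_big_seq => i si; apply: FG; apply: contraNneq na => <-.
have ai : a != i0 by apply: contraNneq na => ->.
by rewrite IHs // FG // !mulrA klin_comm.
Qed.

End KLinear.

Section MultilinearIdentity.
Variables (K : fieldType) (V : lmodType K) (R : rngType).
Variables (rho : R -> endo V) (d : R -> R) (n : nat).
Hypotheses (rhoM : rng_morphism rho) (rhoK : forall r, klin (rho r)).
Hypotheses (dD : derivation rmul d) (n_gt0 : (0 < n)%N).
Hypothesis dn : forall x y,
  rho (d (x ** y)) ^+ n = rho (d x) ^+ n * rho (d y) ^+ n.

Local Notation D x := (rho (d x)).
Local Notation W := (endo V * endo V)%type.

(** An element of [W] stands for an operator together with its derivative; the
derivative of a [K]-combination of elements of [R] depends on the combination,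
not only on the operator. *)
Definition wscale (k : K) (A : W) : W :=
  (scalar_endo V k * A.1, scalar_endo V k * A.2).

Inductive dspan : W -> Prop :=
| dspan_gen r : dspan (rho r, D r)
| dspanD A B : dspan A -> dspan B -> dspan (A + B)
| dspanZ k A : dspan A -> dspan (wscale k A).

Lemma dspan_klin A : dspan A -> klin A.1 /\ klin A.2.
Proof.
elim=> [r|A' B _ [a1 a2] _ [b1 b2]|k A' _ [a1 a2]] /=; split=> //;
  by [apply: klinD|apply: klinM => //; apply: klin_scalar].
Qed.

Lemma dspan0 : dspan 0.
Proof.
have := dspanZ 0 (dspan_gen 0); rewrite /wscale /=; congr dspan.
by congr (_, _); apply: endoP => v; rewrite endo_mulE /= scale0r.
Qed.

Lemma dspan_mull r A : dspan A ->
  dspan (rho r * A.1, D r * A.1 + rho r * A.2).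
Proof.
elim=> [s|A' B _ IA _ IB|k A' _ IA] /=.
- by have := dspan_gen (r ** s); rewrite (rho_dM rhoM dD) (rngM rhoM).
- have := dspanD IA IB; congr dspan; congr (_, _) => /=; rewrite !mulrDr //.
  by rewrite addrACA.
- have := dspanZ k IA; rewrite /wscale /=; congr dspan.
  by rewrite mulrDr !mulrA !(klin_comm _ (rhoK _)).
Qed.

Definition upd (X : 'I_n -> W) (j : 'I_n) (A : W) : 'I_n -> W :=
  fun i => if i == j then A else X i.

Lemma updE X j A : upd X j A j = A. Proof. by rewrite /upd eqxx. Qed.
Lemma updN X j A i : i != j -> upd X j A i = X i.
Proof. by rewrite /upd => /negbTE ->. Qed.
Lemma dspan_upd X j A : (forall i, dspan (X i)) -> dspan A ->
  forall i, dspan (upd X j A i).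
Proof. by move=> hX hA i; rewrite /upd; case: ifP. Qed.

(** Additivity and homogeneity in each argument are only asked over [dspan],
where all operators are [K]-linear and commute with the scalars. *)
Definition multilinear (Psi : ('I_n -> W) -> endo V) : Prop :=
  (forall X j A B, (forall i, dspan (X i)) -> dspan A -> dspan B ->
    Psi (upd X j (A + B)) = Psi (upd X j A) + Psi (upd X j B)) /\
  (forall X j k A, (forall i, dspan (X i)) -> dspan A ->
    Psi (upd X j (wscale k A)) = scalar_endo V k * Psi (upd X j A)).

Lemma multilinear_sum (I : finType) (P : pred I)
    (Psi : I -> ('I_n -> W) -> endo V) :
  (forall i, P i -> multilinear (Psi i)) ->
  multilinear (fun X => \sum_(i | P i) Psi i X).
Proof.
move=> h; split=> [X j A B hX hA hB|X j k A hX hA].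
  by rewrite -big_split; apply: eq_bigr => i /h[-> //].
by rewrite mulr_sumr; apply: eq_bigr => i /h[_ -> //].
Qed.

Lemma multilinear_mulr Psi c : multilinear Psi ->
  multilinear (fun X => Psi X * c).
Proof.
move=> [h1 h2]; split=> [X j A B hX hA hB|X j k A hX hA].
  by rewrite h1 // mulrDl.
by rewrite h2 // mulrA.
Qed.

Lemma multilinear_mull Psi c : klin c -> multilinear Psi ->
  multilinear (fun X => c * Psi X).
Proof.
move=> hc [h1 h2]; split=> [X j A B hX hA hB|X j k A hX hA].
  by rewrite h1 // mulrDr.
by rewrite h2 // !mulrA klin_comm.
Qed.

Lemma multilinear_sub Psi1 Psi2 : multilinear Psi1 -> multilinear Psi2 ->
  multilinear (fun X => Psi1 X - Psi2 X).
Proof.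
move=> [h1 h2] [h3 h4]; split=> [X j A B hX hA hB|X j k A hX hA].
  by rewrite h1 // h3 // opprD addrACA.
by rewrite h2 // h4 // mulrBr.
Qed.

Lemma multilinear_prod (M : 'I_n -> W -> endo V) (g : {ffun 'I_n -> 'I_n}) :
  injectiveb g ->
  (forall i A B, M i (A + B) = M i A + M i B) ->
  (forall i k A, dspan A -> M i (wscale k A) = scalar_endo V k * M i A) ->
  (forall i A, dspan A -> klin (M i A)) ->
  multilinear (fun X => \prod_(i < n) M i (X (g i))).
Proof.
move=> /injectiveP g_inj MD MZ MK.
have gj j : exists2 i, g i = j & forall k, k != i -> g k != j.
  have [h gK hK] := injF_bij g_inj; exists (h j) => // k.
  by apply: contraNneq => <-; rewrite gK.
split=> [X j A B hX hA hB|X j k A hX hA]; have [i0 e0 eN] := gj j.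
- apply: (@prod_slotD _ _ _ i0); rewrite ?index_enum_uniq ?mem_index_enum //.
  + by rewrite e0 !updE.
  + by move=> i /eN ij; rewrite !updN.
  + by move=> i /eN ij; rewrite !updN.
- apply: (@prod_slotZ _ _ _ _ i0); rewrite ?index_enum_uniq ?mem_index_enum //.
  + by rewrite e0 !updE MZ.
  + by move=> i /eN ij; rewrite !updN.
  + by move=> i; apply/MK/dspan_upd.
Qed.

(** The arguments are moved from the generators to their span one by one, so the
induction is on the number [m] of arguments already general. *)
Lemma multilinear_ext Psi : multilinear Psi ->
  (forall x : 'I_n -> R, Psi (fun i => (rho (x i), D (x i))) = 0) ->
  forall X, (forall i, dspan (X i)) -> Psi X = 0.
Proof.
move=> [PsiD PsiZ] Psi0 X hX.
have [m mn genX] : exists2 m, (m <= n)%N &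
    forall i : 'I_n, (m <= i)%N -> exists r, X i = (rho r, D r).
  by exists n => // i; rewrite leqNgt ltn_ord.
elim: m mn X hX genX => [|m IHm] mn X hX genX.
  have /choice[x hx] : forall i, exists r, X i = (rho r, D r).
    by move=> i; apply: genX.
  by rewrite -(Psi0 x); congr Psi; apply/funext.
pose j := Ordinal mn.
suff H A : dspan A -> Psi (upd X j A) = 0.
  rewrite -(H (X j)) //; congr Psi; apply/funext => i; rewrite /upd.
  by case: eqP => [->|].
elim=> [r|A1 A2 h1 IH1 h2 IH2|k A1 h1 IH1].
- apply: IHm; first exact: ltnW.
    by apply: dspan_upd => //; apply: dspan_gen.
  move=> i mi; rewrite /upd; case: eqP => [_|/eqP ij]; first by exists r.
  by apply: genX; rewrite ltn_neqAle mi andbT eq_sym.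
- by rewrite PsiD // IH1 IH2 addr0.
- by rewrite PsiZ // IH1 mulr0.
Qed.

Definition inj_ffun : pred {ffun 'I_n -> 'I_n} := fun g => injectiveb g.

(** Linearizing [f (x y) = f x f y] in [y] and then in [x] gives an identity which
is linear in every argument, and so may be extended to [K]-combinations; the
identity itself may not. *)
Lemma multilinear_identity (X Y : 'I_n -> W) :
  (forall i, dspan (X i)) -> (forall i, dspan (Y i)) ->
  \sum_(h | inj_ffun h) \sum_(g | inj_ffun g)
    \prod_(i < n) ((X (g i)).2 * (Y (h i)).1 + (X (g i)).1 * (Y (h i)).2) =
  (\sum_(g | inj_ffun g) \prod_(i < n) (X (g i)).2) *
  (\sum_(h | inj_ffun h) \prod_(i < n) (Y (h i)).2).
Proof.
have id1 (x y : 'I_n -> R) :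
  \sum_(h | inj_ffun h) \sum_(g | inj_ffun g)
    \prod_(i < n) D (x (g i) ** y (h i)) =
  (\sum_(g | inj_ffun g) \prod_(i < n) D (x (g i))) *
  (\sum_(h | inj_ffun h) \prod_(i < n) D (y (h i))).
  have dDD := rho_dD rhoM dD.
  have LD := rho_dM rhoM dD.
  (* First in [y], with all the factors [x0] equal. *)
  have id0 x0 : \sum_(h | inj_ffun h) \prod_(i < n) D (x0 ** y (h i)) =
     \prod_(i < n) D x0 * \sum_(h | inj_ffun h) \prod_(i < n) D (y (h i)).
    rewrite -(polarization (L := fun _ z => D (x0 ** z))) => [|i u v]; last first.
      by rewrite rmulDr dDD.
    rewrite -(polarization (L := fun _ z => D z)) // mulr_sumr.
    apply: eq_bigr => S _; rewrite !prodr_const !card_ord dn.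
    by rewrite mulrA [in RHS]mulrA; congr (_ * _); rewrite commr_sign.
  rewrite -(polarization (L := fun _ z => D z)) // mulr_suml.
  under eq_bigr => h _.
    rewrite -(polarization (L := fun i z => D (z ** y (h i)))); last first.
      by move=> i u v; rewrite rmulDl dDD.
    over.
  rewrite exchange_big /=; apply: eq_bigr => S _.
  by rewrite -mulr_sumr id0 mulrA.
move=> hX hY; apply/eqP; rewrite -subr_eq0; apply/eqP.
pose Phi X Y := \sum_(h | inj_ffun h) \sum_(g | inj_ffun g)
    \prod_(i < n) ((X (g i)).2 * (Y (h i)).1 + (X (g i)).1 * (Y (h i)).2) -
  (\sum_(g | inj_ffun g) \prod_(i < n) (X (g i)).2) *
  (\sum_(h | inj_ffun h) \prod_(i < n) ((Y (h i)).2 : endo V)).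
have PhiX (Z : 'I_n -> W) : (forall i, dspan (Z i)) -> multilinear (Phi^~ Z).
  move=> hZ; have hZ1 i := (dspan_klin (hZ i)).1;
    have hZ2 i := (dspan_klin (hZ i)).2.
  apply: multilinear_sub.
    apply: multilinear_sum => h _; apply: multilinear_sum => g ginj.
    apply: (multilinear_prod (M := fun i A => A.2 * (Z (h i)).1 + A.1 * (Z (h
      i)).2)) => //.
    - by move=> i A B; rewrite !mulrDl addrACA.
    - by move=> i k A hA; rewrite mulrDr !mulrA.
    - move=> i A /dspan_klin[h1 h2].
      by apply: klinD; apply: klinM.
  apply: multilinear_mulr; apply: multilinear_sum => g ginj.
  by apply: (multilinear_prod (M := fun _ A => A.2)) => // i A /dspan_klin[].
have PhiY (Z : 'I_n -> W) : (forall i, dspan (Z i)) -> multilinear (Phi Z).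
  move=> hZ; have hZ1 i := (dspan_klin (hZ i)).1;
    have hZ2 i := (dspan_klin (hZ i)).2.
  apply: multilinear_sub.
    apply: multilinear_sum => h hinj; apply: multilinear_sum => g _.
    apply: (multilinear_prod (M := fun i A => (Z (g i)).2 * A.1 + (Z (g i)).1 *
      A.2)) => //.
    - by move=> i A B; rewrite !mulrDr addrACA.
    - move=> i k A hA; rewrite mulrDr !mulrA /=.
      by rewrite !(klin_comm _ (hZ2 _)) !(klin_comm _ (hZ1 _)).
    - move=> i A /dspan_klin[h1 h2].
      by apply: klinD; apply: klinM.
  apply: multilinear_mull.
    elim/big_ind: _; [exact: klin0|exact: klinD|].
    by move=> g _; apply: klin_prod.
  apply: multilinear_sum => g ginj.
  by apply: (multilinear_prod (M := fun _ A => A.2)) => // i A /dspan_klin[].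
apply: (multilinear_ext (PhiY X hX)) hY => y.
apply: (multilinear_ext (PhiX _ _)) hX => [i|x]; first exact: dspan_gen.
rewrite /Phi /= -id1; apply/eqP; rewrite subr_eq0; apply/eqP.
apply: eq_bigr => h _; apply: eq_bigr => g _; apply: eq_bigr => i _.
by rewrite (rho_dM rhoM dD).
Qed.

End MultilinearIdentity.

(** * Density *)
Section Families.
Variables (K : fieldType) (V : lmodType K).

(** Families are indexed by [nat] and only their first [m] members count; this
makes it easy to extend them one by one. *)
Definition indep (m : nat) (q : nat -> V) : Prop :=
  forall mu : nat -> K, \sum_(i < m) mu i *: q i = 0 ->
  forall i, (i < m)%N -> mu i = 0.

Definition inspan (m : nat) (q : nat -> V) : set V :=
  [set v | exists mu : nat -> K, v = \sum_(i < m) mu i *: q i].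

End Families.

Section Density.
Variables (K : fieldType) (V : lmodType K) (R : rngType).
Variables (rho : R -> endo V) (d : R -> R) (n : nat).
Hypotheses (rhoM : rng_morphism rho) (rhoK : forall r, klin (rho r)).
Hypotheses (dD : derivation rmul d) (n_gt0 : (0 < n)%N).
Hypothesis dn : forall x y,
  rho (d (x ** y)) ^+ n = rho (d x) ^+ n * rho (d y) ^+ n.

Definition submodule (N : set V) : Prop :=
  [/\ N 0, forall u v, N u -> N v -> N (u + v),
      forall k v, N v -> N (k *: v) & forall r v, N v -> N (rho r v)].

Definition irreducible_module : Prop :=
  (exists r v, rho r v <> 0) /\
  (forall N, submodule N -> (exists2 v, N v & v <> 0) -> forall w, N w).

Definition scalar_centralizer : Prop :=
  forall T : endo V, klin T -> (forall r, T * rho r = rho r * T) ->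
  exists k, T = scalar_endo V k.

Hypotheses (irr : irreducible_module) (cent : scalar_centralizer).

Local Notation D x := (rho (d x)).
Local Notation dspan := (dspan rho d).

Lemma nonzero_action v : v <> 0 -> exists r, rho r v <> 0.
Proof.
have [[r0 [v0 rv0]] hN] := irr.
move=> v0'; apply: contrapT => /forallNP h.
apply: rv0; apply: (hN [set v | forall r, rho r v = 0] _ _ v0).
- split=> [r|u w hu hw r|k w hw r|s w hw r].
  + by rewrite endo0.
  + by rewrite endoD hu hw addr0.
  + by rewrite rhoK hw scaler0.
  + by rewrite -endo_mulE -(rngM rhoM) hw.
- by exists v => // r; apply: contrapT; apply: h.
Qed.

(** The density theorem, for submodules [N] of [V^m].  By induction [N] projects
onto the first [m] coordinates.  Either it contains a vector supported in the
last one, and then all of them, or it is the graph of a homomorphism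
[V^m -> V], whose components are scalars because the centralizer is [K]; this
graph is killed by a nonzero linear form. *)
Lemma submod_full m (N : set (nat -> V)) :
  N (fun=> 0) ->
  (forall a b, N a -> N b -> N (fun i => a i + b i)) ->
  (forall k a, N a -> N (fun i => k *: a i)) ->
  (forall r a, N a -> N (fun i => rho r (a i))) ->
  (forall mu : nat -> K, (forall a, N a -> \sum_(i < m) mu i *: a i = 0) ->
     forall i, (i < m)%N -> mu i = 0) ->
  forall w, exists2 a, N a & forall i, (i < m)%N -> a i = w i.
Proof.
move=> N0 ND NZ Nrho; elim: m => [|m IHm] Nfaith w; first by exists (fun=> 0).
have {}IHm : forall w, exists2 a, N a & forall i, (i < m)%N -> a i = w i.
  apply: IHm => mu hmu i im.
  have := Nfaith (fun i => if (i < m)%N then mu i else 0) _ i (ltnW im).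
  rewrite im; apply=> a Na; rewrite big_ord_recr /= ltnn scale0r addr0.
  by rewrite -[RHS](hmu a Na); apply: eq_bigr => j _; rewrite ltn_ord.
pose N1 : set V := [set v | exists a, [/\ N a, forall i, (i < m)%N -> a i = 0 &
  a m = v]].
have N1sub : submodule N1.
  split.
  - by exists (fun=> 0).
  - move=> _ _ [a [Na a0 <-]] [b [Nb b0 <-]]; exists (fun i => a i + b i).
    by split=> // [|i im]; [exact: ND|rewrite a0 // b0 // addr0].
  - move=> k _ [a [Na a0 <-]]; exists (fun i => k *: a i).
    by split=> // [|i im]; [exact: NZ|rewrite a0 // scaler0].
  - move=> r _ [a [Na a0 <-]]; exists (fun i => rho r (a i)).
    by split=> // [|i im]; [exact: Nrho|rewrite a0 // endo0].
have [N1nz|N1z] := pselect (exists2 v, N1 v & v <> 0).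
  have N1T := irr.2 _ N1sub N1nz.
  have [a Na aw] := IHm w; have [b [Nb b0 bm]] := N1T (w m - a m).
  exists (fun i => a i + b i) => [|i]; first exact: ND.
  rewrite ltnS leq_eqVlt => /orP[/eqP ->|im]; first by rewrite bm addrC subrK.
  by rewrite aw // b0 // addr0.
have graph a : N a -> (forall i, (i < m)%N -> a i = 0) -> a m = 0.
  move=> Na a0; apply: contrapT => am; apply: N1z; exists (a m) => //.
  by exists a.
have graph2 a b : N a -> N b -> (forall i, (i < m)%N -> a i = b i) -> a m = b m.
  move=> Na Nb ab; apply/eqP; rewrite -subr_eq0 -scaleN1r; apply/eqP.
  apply: (graph (fun i => a i + -1 *: b i)); first by apply: ND => //; apply: NZ.
  by move=> i im /=; rewrite ab // scaleN1r subrr.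
have /choice[f hf] : forall jw : nat * V, exists a, N a /\
    forall i, (i < m)%N -> a i = if i == jw.1 then jw.2 else 0.
  by move=> jw; have [a] := IHm (fun i => if i == jw.1 then jw.2 else 0); exists a.
have fN j v : N (f (j, v)) by case: (hf (j, v)).
have fE j v i : (i < m)%N -> f (j, v) i = if i == j then v else 0.
  by move=> im; case: (hf (j, v)) => _ /= ->.
have phiD j u v : f (j, u + v) m = f (j, u) m + f (j, v) m.
  apply: (graph2 _ (fun i => f (j, u) i + f (j, v) i)) => // [|i im];
    first exact: ND.
  by rewrite !fE //; case: ifP; rewrite ?addr0.
pose phi j : endo V := Endo (phiD j).
have /choice[mu hmu] : forall j, exists k, phi j = scalar_endo V k.
  move=> j; apply: cent.
    move=> k v; rewrite /phi /=.
    apply: (graph2 _ (fun i => k *: f (j, v) i)) => // [|i im].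
      exact/NZ/fN.
    by rewrite !fE //; case: ifP; rewrite ?scaler0.
  move=> r; apply: endoP => v; rewrite !endo_mulE /phi /=.
  apply: (graph2 _ (fun i => rho r (f (j, v) i))) => // [|i im].
    exact/Nrho/fN.
  by rewrite !fE //; case: ifP; rewrite ?endo0.
have := Nfaith (fun i => if i == m then -1 else mu i) _ m (ltnSn m).
rewrite eqxx => h; suff /eqP : (-1 : K) = 0 by rewrite oppr_eq0 oner_eq0.
apply: h => a Na; rewrite big_ord_recr /= eqxx scaleN1r.
apply/eqP; rewrite subr_eq0; apply/eqP.
have NS k : N (fun i => \sum_(j < k) f (nat_of_ord j, a j) i).
  elim: k => [|k IHk].
    by rewrite (_ : (fun _ => _) = fun=> 0) //; apply/funext => i; rewrite big_ord0.
  rewrite (_ : (fun _ => _) = fun i => \sum_(j < k) f (nat_of_ord j, a j) i + f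
    (k, a k) i).
    exact: ND.
  by apply/funext => i; rewrite big_ord_recr.
rewrite (graph2 _ _ Na (NS m)) => [|i im].
  apply: eq_bigr => j _; rewrite (ltn_eqF (ltn_ord j)).
  by have := congr1 (fun T : endo V => T (a j)) (hmu j) => /= ->.
rewrite (bigD1 (Ordinal im)) //= fE // eqxx big1 ?addr0 // => j ij.
rewrite fE //; case: eqP => // e; case/eqP: ij; exact: val_inj.
Qed.

Lemma wscale1E k (A : endo V * endo V) v : (wscale k A).1 v = k *: A.1 v.
Proof. by []. Qed.
Lemma wscale2E k (A : endo V * endo V) v : (wscale k A).2 v = k *: A.2 v.
Proof. by []. Qed.

Lemma density m q : indep m q -> forall w : nat -> V,
  exists A, dspan A /\ forall i, (i < m)%N -> A.1 (q i) = w i.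
Proof.
move=> qi w.
have [||||mu hmu i im|a [A hA ->] aw] := @submod_full m
  [set a | exists2 A, dspan A & a = fun i => A.1 (q i)] _ _ _ _ _ w.
- by exists 0 => //; apply: dspan0.
- by move=> _ _ [A hA ->] [B hB ->]; exists (A + B) => //; apply: dspanD.
- by move=> k _ [A hA ->]; exists (wscale k A) => //; apply: dspanZ.
- move=> r _ [A hA ->]; exists (rho r * A.1, D r * A.1 + rho r * A.2) => //.
  exact: dspan_mull.
- apply: qi im; apply: contrapT => /nonzero_action[r]; apply.
  rewrite -[RHS](hmu (fun i => rho r (q i))) ?endo_sumr; last first.
    by exists (rho r, D r) => //; apply: dspan_gen.
  by apply: eq_bigr => j _; rewrite rhoK.
- by exists A; split.
Qed.

Definition free_for_derivation m q : Prop := forall w : nat -> V, exists A,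
  [/\ dspan A, forall i, (i < m)%N -> A.1 (q i) = 0 &
      forall i, (i < m)%N -> A.2 (q i) = w i].

(** Otherwise some combination [u] of the family is killed by every [x'] for which
[x] kills the family.  By density, [x' u] then depends only on the values of
[x], and sending [x q_i0] to [x' u], for the [x] that kill the other members,
defines [T] up to a scalar. *)
Lemma not_free_inner m q : indep m q -> ~ free_for_derivation m q ->
  exists2 T : endo V, klin T & forall r, D r = T * rho r - rho r * T.
Proof.
move=> qi qnf.
pose N : set (nat -> V) := [set a | exists A,
  [/\ dspan A, forall i, (i < m)%N -> A.1 (q i) = 0 &
      forall i, (i < m)%N -> a i = A.2 (q i)]].
have [mu hmu [i0 i0m mui0]] : exists2 mu : nat -> K,
    forall a, N a -> \sum_(i < m) mu i *: a i = 0 &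
    exists2 i, (i < m)%N & mu i <> 0.
  apply: contrapT => h; apply: qnf => w.
  have [||||mu hmu i im|a [A [hA A0 aA]] aw] := @submod_full m N _ _ _ _ _ w.
  - by exists 0; split=> //; apply: dspan0.
  - move=> a b [A [hA A0 aA]] [B [hB B0 bB]]; exists (A + B); split=> [|i im|i im].
    + exact: dspanD.
    + by rewrite endo_addE A0 // B0 // addr0.
    + by rewrite endo_addE aA // bB.
  - move=> k a [A [hA A0 aA]]; exists (wscale k A); split=> [|i im|i im].
    + exact: dspanZ.
    + by rewrite wscale1E A0 // scaler0.
    + by rewrite wscale2E aA.
  - move=> r a [A [hA A0 aA]].
    exists (rho r * A.1, D r * A.1 + rho r * A.2); split=> [|i im|i im] /=.
    + exact: dspan_mull.
    + by rewrite ?endo_mulE A0 // endo0.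
    + by rewrite ?endo_addE ?endo_mulE A0 // endo0 add0r aA.
  - by apply: contrapT => mui; apply: h; exists mu => //; exists i.
  - by exists A; split=> // i im; rewrite -aA // aw.
pose u := \sum_(i < m) mu i *: q i.
have Nu A : dspan A -> (forall i, (i < m)%N -> A.1 (q i) = 0) -> A.2 u = 0.
  move=> hA A0; have [_ A2K] := dspan_klin rhoK hA.
  rewrite endo_sumr -[RHS](hmu (fun i => A.2 (q i))); last by exists A.
  by apply: eq_bigr => i _; rewrite A2K.
have /choice[f hf] : forall w : V, exists A, dspan A /\
    forall i, (i < m)%N -> A.1 (q i) = if i == i0 then w else 0.
  by move=> w; apply: (density qi (fun i => if i == i0 then w else 0)).
have fS w : dspan (f w) by case: (hf w).
have f2 w A : dspan A ->
    (forall i, (i < m)%N -> A.1 (q i) = if i == i0 then w else 0) ->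
    A.2 u = (f w).2 u.
  move=> hA A1; apply/eqP; rewrite -subr_eq0; apply/eqP.
  have := Nu (A + wscale (-1) (f w)) _ _.
  rewrite endo_addE wscale2E scaleN1r; apply.
    by apply: dspanD => //; apply: dspanZ.
  move=> i im; rewrite endo_addE wscale1E scaleN1r A1 //.
  by case: (hf w) => _ -> //; rewrite subrr.
have f1u w : (f w).1 u = mu i0 *: w.
  have [fK _] := dspan_klin rhoK (fS w).
  rewrite endo_sumr (bigD1 (Ordinal i0m)) //= fK; case: (hf w) => _ fw.
  rewrite fw // eqxx big1 ?addr0 // => i ii0; rewrite fK fw //.
  case: eqP => [e|]; last by rewrite scaler0.
  by case/eqP: ii0; apply: val_inj.
have TD v w : (mu i0)^-1 *: (f (v + w)).2 u =
    (mu i0)^-1 *: (f v).2 u + (mu i0)^-1 *: (f w).2 u.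
  rewrite -scalerDr; congr (_ *: _); rewrite -(f2 _ (f v + f w)) //.
    exact: dspanD.
  move=> i im; rewrite endo_addE; case: (hf v) => _ -> //; case: (hf w) => _ -> //.
  by case: ifP; rewrite ?addr0.
exists (Endo TD) => [k v|r] /=.
  rewrite -(f2 _ (wscale k (f v))) ?wscale2E ?scalerA 1?mulrC //.
    exact: dspanZ.
  move=> i im; rewrite wscale1E; case: (hf v) => _ -> //.
  by case: ifP; rewrite ?scaler0.
apply: endoP => v; rewrite endo_subE !endo_mulE /=.
rewrite -(f2 _ (rho r * (f v).1, D r * (f v).1 + rho r * (f v).2)) /=.
- rewrite ?endo_addE ?endo_mulE f1u.
  have DrK : klin (D r) by [].
  rewrite DrK scalerDr scalerA mulVf ?scale1r; last exact/eqP.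
  by rewrite rhoK addrK.
- exact: dspan_mull.
- move=> i im; rewrite ?endo_mulE; case: (hf v) => _ -> //.
  by case: ifP; rewrite ?endo0.
Qed.

(** The operator [Z i] moves the chain down from [p (g i).+1] to [p (g i)], and
kills the rest; so the product goes all the way only if the steps come in the
right order. *)
Lemma chain_prod m (p : nat -> V) (Z : nat -> endo V) (g : nat -> nat) :
  (forall j i, (j < m)%N -> (i < m)%N ->
     Z i (p j.+1) = if g i == j then p j else 0) ->
  (\prod_(i < m) Z i) (p m) =
    if [forall i : 'I_m, g i == i] then p 0%N else 0.
Proof.
elim: m => [|m IHm] hZ.
  by rewrite big_ord0 endo_oneE; case: ifP => // /negbT/forallPn[[]].
rewrite big_ord_recr /= ?endo_mulE hZ //; have [gm|gm] := eqVneq (g m) m.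
  rewrite IHm => [|j i jm im]; last by rewrite hZ // ltnW.
  congr (if _ then _ else _); apply/forallP/forallP => h i; last first.
    exact: (h (widen_ord (leqnSn m) i)).
  case: (unliftP ord_max i) => [j ->|->] /=; last by rewrite gm.
  by rewrite /bump leqNgt ltn_ord; apply: h.
rewrite endo0; case: ifP => // /forallP/(_ ord_max) /=.
by rewrite (negbTE gm).
Qed.

Lemma sum_chain (p : nat -> V) (Z : 'I_n -> endo V) :
  (forall j k, (j < n)%N -> Z k (p j.+1) = if k == j :> nat then p j else 0) ->
  (\sum_(g : {ffun 'I_n -> 'I_n} | inj_ffun g) \prod_(i < n) Z (g i)) (p n) = p 0%N.
Proof.
case: n n_gt0 Z => // n' _ Z hZ.
have prodE (g : {ffun 'I_n'.+1 -> 'I_n'.+1}) : (\prod_(i < n'.+1) Z (g i)) (p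
  n'.+1) =
    if g == finfun id then p 0%N else 0.
  rewrite (eq_bigr (fun i : 'I_n'.+1 => Z (g (inord i)))); last first.
    by move=> i _; rewrite !inord_val.
  rewrite (chain_prod (Z := fun k => Z (g (inord k))) (g := fun k => g (inord k))).
    congr (if _ then _ else _); apply/forallP/eqP => [h|-> i].
      apply/ffunP => i; rewrite ffunE; apply: val_inj => /=.
      by have := h i; rewrite inord_val => /eqP.
    by rewrite ffunE inord_val.
  by move=> j i jn _; rewrite hZ.
rewrite endo_suml (bigD1 (finfun id)) /=; last first.
  by apply/injectiveP => i j; rewrite !ffunE.
rewrite prodE eqxx big1 ?addr0 // => g /andP[_ /negbTE gid].
by rewrite prodE gid.
Qed.

(** Let [X_i] and [Y_i] kill the family while the [X_i'] and [Y_i'] are the [2n]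
steps of a chain [q_(2n-1) -> ... -> q_0 -> e].  On the right of the linearized
identity only the products in the right order survive, and they lead to
[e <> 0]; on the left, every factor [X' Y + X Y'] kills the start of the
chain. *)
Lemma no_free_family q : ~ free_for_derivation (n + n) q.
Proof.
move=> qf; have [[r0 [e re]] _] := irr.
have e0 : e <> 0 by move=> e0; apply: re; rewrite e0 endo0.
pose p i := if i is i'.+1 then q i' else e.
have /choice[f hf] : forall k : nat, exists A,
  [/\ dspan A, forall i, (i < n + n)%N -> A.1 (q i) = 0 &
    forall i, (i < n + n)%N -> A.2 (q i) = if k == i then p i else 0].
  by move=> k; apply: (qf (fun i => if k == i then p i else 0)).
have fS k : dspan (f k) by case: (hf k).
have f1 k i : (i < n + n)%N -> (f k).1 (q i) = 0 by case: (hf k) => _ + _; apply.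
have f2 k i : (i < n + n)%N -> (f k).2 (q i) = if k == i then p i else 0.
  by case: (hf k) => _ _; apply.
pose X (i : 'I_n) := f i; pose Y (i : 'I_n) := f (n + i)%N.
have := multilinear_identity rhoM rhoK dD dn (X := X) (Y := Y).
move=> /(_ (fun i => fS _) (fun i => fS _)) /(congr1 (fun T : endo V => T (p (n
  + n)%N))).
rewrite endo_mulE (sum_chain (p := fun j => p (n + j)%N) (Z := fun i => (Y
  i).2)); last first.
  move=> j k jn; rewrite addnS /= f2 ?ltn_add2l //.
  by rewrite eqn_add2l.
rewrite addn0 (sum_chain (Z := fun i => (X i).2)); last first.
  by move=> j k jn; rewrite /= f2 // ltn_addr.
rewrite endo_suml big1 => [/esym|h _]; first exact: e0.
rewrite endo_suml big1 // => g _.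
rewrite {}/X {}/Y; move: g h.
case: n n_gt0 f1 f2 => // n' _ f1 f2 g h.
rewrite big_ord_recr /= ?endo_mulE ?endo_addE ?endo_mulE addnS.
have lt2 : ((n' + n').+1 < n'.+1 + n'.+1)%N by rewrite addSn addnS.
rewrite f1 // endo0 add0r f2 //.
case: ifP => _; last by rewrite !endo0.
by rewrite /= f1 ?endo0 // ltnW.
Qed.

End Density.

(** * The derivatives have finite rank *)
Section FiniteDimension.
Variables (K : fieldType) (V : lmodType K).
Implicit Types (S : set V) (q : nat -> V) (x : endo V).

Definition findim S : Prop := exists m q, S `<=` inspan m q.

Definition subspace S : Prop :=
  [/\ S 0, forall u v, S u -> S v -> S (u + v) & forall k v, S v -> S (k *: v)].

Definition finrank x : Prop := findim (range x).

Lemma subspaceB S u v : subspace S -> S u -> S v -> S (u - v).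
Proof. by case=> S0 SD SZ Su Sv; rewrite -scaleN1r; apply/SD/SZ. Qed.

Lemma inspan_subspace m q : subspace (inspan m q).
Proof.
split.
- by exists (fun=> 0); rewrite big1 // => i _; rewrite scale0r.
- move=> _ _ [mu ->] [nu ->]; exists (fun i => mu i + nu i).
  by rewrite -big_split; apply: eq_bigr => i _; rewrite scalerDl.
- move=> k _ [mu ->]; exists (fun i => k * mu i).
  by rewrite scaler_sumr; apply: eq_bigr => i _; rewrite scalerA.
Qed.

Lemma findim_sub S S' : S `<=` S' -> findim S' -> findim S.
Proof. by move=> SS' [m [q h]]; exists m, q => v /SS'/h. Qed.

Lemma findim_inspan m q : findim (inspan m q).
Proof. by exists m, q. Qed.

Definition catfam m q q' : nat -> V := fun i => if (i < m)%N then q i else q'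
  (i - m)%N.

Lemma sum_catfam m m' q q' (mu : nat -> K) :
  \sum_(i < m + m') mu i *: catfam m q q' i =
  \sum_(i < m) mu i *: q i + \sum_(i < m') mu (m + i)%N *: q' i.
Proof.
rewrite big_split_ord; congr (_ + _); apply: eq_bigr => i _ /=.
  by rewrite /catfam ltn_ord.
by rewrite /catfam ltnNge leq_addr /= addKn.
Qed.

Lemma inspan_cat m m' q q' u v : inspan m q u -> inspan m' q' v ->
  inspan (m + m') (catfam m q q') (u + v).
Proof.
move=> [mu ->] [nu ->].
exists (fun i => if (i < m)%N then mu i else nu (i - m)%N).
rewrite (sum_catfam _ _ _ _ (fun i => if (i < m)%N then mu i else nu (i - m)%N)).
congr (_ + _); apply: eq_bigr => i _; first by rewrite ltn_ord.
by rewrite ltnNge leq_addr /= addKn.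
Qed.

Lemma findimD S S' : findim S -> findim S' ->
  findim [set w | exists u v, [/\ S u, S' v & w = u + v]].
Proof.
move=> [m [q h]] [m' [q' h']]; exists (m + m')%N, (catfam m q q').
by move=> _ [u [v [/h Su /h' Sv ->]]]; apply: inspan_cat.
Qed.

Lemma findim_image x S : klin x -> findim S -> findim (x @` S).
Proof.
move=> xK [m [q h]]; exists m, (fun i => x (q i)) => _ [v /h[mu ->] <-].
by exists mu; rewrite endo_sumr; apply: eq_bigr => i _; rewrite xK.
Qed.

Lemma finrank_mull x y : klin x -> finrank y -> finrank (x * y).
Proof.
move=> xK /(findim_image xK); apply: findim_sub => _ [v _ <-].
by exists (y v) => //; exists v.
Qed.

Lemma finrank_mulr x y : finrank x -> finrank (x * y).
Proof. by apply: findim_sub => _ [v _ <-]; exists (y v). Qed.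

Lemma finrankB x y : finrank x -> finrank y -> finrank (x - y).
Proof.
move=> hx hy; have := findimD hx (findim_image (@klinN _ _ _ (@klin1 _ _)) hy).
apply: findim_sub => _ [v _ <-]; exists (x v), (- y v); split=> //.
by exists (y v) => //; exists v.
Qed.

Lemma indep_extend m q v : indep m q -> ~ inspan m q v ->
  indep m.+1 (fun i => if i == m then v else q i).
Proof.
move=> qi qv mu; rewrite big_ord_recr /= eqxx => mu0.
have qE : \sum_(i < m) mu i *: (if nat_of_ord i == m then v else q i) =
    \sum_(i < m) mu i *: q i.
  by apply: eq_bigr => i _; rewrite ltn_eqF.
rewrite qE in mu0.
have mum : mu m = 0.
  apply: contrapT => /eqP mum; apply: qv.
  exists (fun i => - (mu m)^-1 * mu i); apply: (scalerI mum).
  rewrite scaler_sumr (eq_bigr (fun i : 'I_m => - (mu i *: q i))) => [|i _].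
    by rewrite sumrN; apply/eqP; rewrite -addr_eq0 addrC mu0.
  by rewrite scalerA mulrA mulrN mulfV // mulN1r scaleNr.
rewrite mum scale0r addr0 in mu0.
move=> i; rewrite ltnS leq_eqVlt => /orP[/eqP -> //|im]; exact: qi im.
Qed.

(** Modulo [U] every vector is an eigenvector of [T]; as usual the eigenvalues of
[v], [v0] and [v + v0] agree when [v] and [v0] are independent modulo [U]. *)
Lemma scalar_mod_findim (T : endo V) U : klin T -> ~ findim [set: V] ->
  subspace U -> findim U ->
  (forall v, exists a b : K, (a != 0) || (b != 0) /\ U (a *: v + b *: T v)) ->
  exists k, finrank (T - scalar_endo V k).
Proof.
move=> TK Vinf Usub Ufin hU; have [U0 UD UZ] := Usub.
have eig v : ~ U v -> exists k, U (T v - k *: v).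
  move=> Uv; have [a [b [ab Uab]]] := hU v.
  have b0 : b != 0.
    apply/negP => /eqP b0; move: ab Uab; rewrite b0 eqxx orbF scale0r addr0.
    by move=> a0 /(UZ a^-1); rewrite scalerA mulVf // scale1r.
  exists (- (b^-1 * a)); have := UZ b^-1 _ Uab.
  by rewrite scalerDr !scalerA mulVf // scale1r scaleNr opprK addrC.
have [v0 Uv0] : exists v, ~ U v.
  by apply: contrapT => /forallNP h; apply: Vinf;
    apply: findim_sub Ufin => v _; apply: contrapT.
have [k Uk] := eig v0 Uv0; exists k; set F := T - _.
have FK : klin F by apply/klinD => //; apply/klinN/klin_scalar.
apply: findim_sub (findimD Ufin (findim_image FK Ufin)) => _ [v _ <-].
have [[c [u [Uu vE]]]|vN] := pselect (exists c u, U u /\ v = u + c *: v0).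
  exists (c *: F v0), (F u); split; [exact: UZ|by exists u|].
  by rewrite vE endoD FK addrC.
exists (F v), 0; split; [|by exists 0 => //; rewrite endo0|by rewrite addr0].
have Uv : ~ U v by move=> Uv; apply: vN; exists 0, v; rewrite scale0r addr0.
have Uvv0 : ~ U (v + v0).
  move=> Uvv0; apply: vN; exists (-1), (v + v0); split=> //.
  by rewrite scaleN1r addrK.
have [k1 Uk1] := eig v Uv; have [k2 Uk2] := eig _ Uvv0.
have Ulin : U ((k1 - k2) *: v + (k - k2) *: v0).
  have := subspaceB Usub (subspaceB Usub Uk2 Uk1) Uk; congr U.
  rewrite endoD scalerDr !scalerBl opprD addrACA !opprB.
  rewrite [X in X + (k *: v0 - T v0)]addrAC.
  rewrite [X in X + (T v0 - _)]addrC subrKA -addrA; congr (_ + _).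
  by rewrite addrC subrKA.
have k12 : k1 = k2.
  apply/eqP; rewrite -subr_eq0; apply/negP => /negP k12; apply: vN.
  exists (- ((k1 - k2)^-1 * (k - k2))), ((k1 - k2)^-1 *: ((k1 - k2) *: v + (k -
    k2) *: v0)).
  split; first exact: UZ.
  by rewrite scalerDr !scalerA mulVf // scale1r scaleNr addrK.
have kk2 : k = k2.
  apply/eqP; rewrite -subr_eq0; apply/negP => /negP kk2; apply: Uv0.
  have := UZ (k - k2)^-1 _ Ulin.
  by rewrite k12 subrr scale0r add0r scalerA mulVf // scale1r.
by rewrite /F endo_subE /= kk2 -k12.
Qed.

End FiniteDimension.

Section InnerOrFiniteRank.
Variables (K : fieldType) (V : lmodType K) (R : rngType).
Variables (rho : R -> endo V) (d : R -> R) (n : nat).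
Hypotheses (rhoM : rng_morphism rho) (rhoK : forall r, klin (rho r)).
Hypotheses (dD : derivation rmul d) (n_gt0 : (0 < n)%N).
Hypothesis dn : forall x y,
  rho (d (x ** y)) ^+ n = rho (d x) ^+ n * rho (d y) ^+ n.
Hypotheses (irr : irreducible_module rho) (cent : scalar_centralizer rho).
Local Notation D x := (rho (d x)).

(** In an infinite-dimensional [V], independent families cannot be free, so
[d x = [T, x]].  If [T] is not a scalar plus an operator of finite rank, there
are [z_i] such that the [z_i] and the [T z_i] are independent together, and
density makes such a family free, because [x' z = - x (T z)] when [x z = 0]. *)
Lemma derivation_finrank r : finrank (D r).
Proof.
have [Vfin|Vinf] := pselect (findim [set: V]).
  by apply: findim_sub Vfin => v.
have [q qi] : exists q : nat -> V, indep (n + n) q.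
  elim: (n + n)%N => [|m [q qi]]; first by exists (fun=> 0) => mu _ [].
  have [v qv] : exists v, ~ inspan m q v.
    apply: contrapT => /forallNP h; apply: Vinf; exists m, q => v _.
    exact: contrapT.
  by exists (fun i => if i == m then v else q i); apply: indep_extend.
have nofree := no_free_family rhoM rhoK dD n_gt0 dn irr.
have [T TK TD] := not_free_inner rhoM rhoK dD irr cent qi (nofree q).
have [[k kT]|Tgen] := pselect (exists k, finrank (T - scalar_endo V k)).
  have -> : D r = (T - scalar_endo V k) * rho r - rho r * (T - scalar_endo V k).
    rewrite TD mulrBl mulrBr klin_comm //.
    by rewrite opprB addrA subrK.
  by apply: finrankB; [apply: finrank_mulr|apply: finrank_mull].
suff [z zi] : exists z : nat -> V, indep (n + n + (n + n)) (catfam (n + n) z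
  (fun i => T (z i))).
  case: (nofree z) => w.
  have [A [hA Az]] := density rhoM rhoK dD irr cent zi
     (catfam (n + n) (fun=> 0) (fun i => - w i)).
  have A1 i : (i < n + n)%N -> A.1 (z i) = 0.
    by move=> im; have := Az i (ltn_addr _ im); rewrite /catfam im.
  have A2 i : (i < n + n)%N -> A.1 (T (z i)) = - w i.
    move=> im; have := Az (n + n + i)%N; rewrite ltn_add2l => /(_ im).
    by rewrite /catfam ltnNge leq_addr /= addKn.
  have AT : A.2 = T * A.1 - A.1 * T.
    elim: hA => [s|B C _ IB _ IC|k B _ IB] //=.
      by rewrite IB IC mulrDr mulrDl opprD addrACA.
    by rewrite IB mulrBr !mulrA klin_comm.
  exists A; split=> // i im.
  by rewrite AT endo_subE !endo_mulE A1 // endo0 A2 // sub0r opprK.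
elim: (n + n)%N => [|m [z zi]]; first by exists (fun=> 0) => mu _ [].
pose U := inspan (m + m) (catfam m z (fun i => T (z i))).
have [v Uv] : exists v, forall a b : K, U (a *: v + b *: T v) -> a = 0 /\ b = 0.
  apply: contrapT => /forallNP h; apply: Tgen.
  apply: (scalar_mod_findim (U := U) TK Vinf (inspan_subspace _ _)
    (findim_inspan _ _)) => v.
  apply: contrapT => /forallNP h'; apply: (h v) => a b Uab.
  apply: contrapT => ab; have /forallNP/(_ b) := h' a; apply; split=> //.
  by rewrite -negb_and; apply/negP => /andP[/eqP a0 /eqP b0]; apply: ab.
exists (fun i => if i == m then v else z i) => mu.
rewrite sum_catfam !big_ord_recr /= eqxx.
have zE (f : V -> V) (nu : nat -> K) : \sum_(i < m) nu i *: f (if nat_of_ord i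
  == m then v else z i) =
    \sum_(i < m) nu i *: f (z i).
  by apply: eq_bigr => i _; rewrite ltn_eqF.
rewrite (zE id) (zE T (fun i => mu (m.+1 + i)%N)) addrACA => mu0.
have [mum mum'] : mu m = 0 /\ mu (m.+1 + m)%N = 0.
  apply: Uv; rewrite [X in U X](_ : _ = - (\sum_(i < m) mu i *: z i + \sum_(i <
    m) mu (m.+1 + i)%N *: T (z i))).
    rewrite -scaleN1r; have [_ _ UZ] := inspan_subspace (m + m) (catfam m z
      (fun i => T (z i))).
    apply: UZ; apply: inspan_cat; first by exists mu.
    by exists (fun i => mu (m.+1 + i)%N).
  by apply/eqP; rewrite -addr_eq0 addrC mu0.
rewrite mum mum' !scale0r !addr0 in mu0.
pose nu i := if (i < m)%N then mu i else mu i.+1.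
have nu0 : forall i, (i < m + m)%N -> nu i = 0.
  apply: zi; rewrite sum_catfam -[RHS]mu0; congr (_ + _); apply: eq_bigr => i _.
    by rewrite /nu ltn_ord.
  by rewrite /nu ltnNge leq_addr /= -addSn.
move=> i; have [im _|mi im'] := ltnP i m.
  by have := nu0 i (ltn_addr _ im); rewrite /nu im.
move: mi; rewrite leq_eqVlt => /orP[/eqP <- //|mi].
have [->//|ii] := eqVneq i (m.+1 + m)%N.
case: i mi im' ii => // i mi im' ii.
have := nu0 i; rewrite /nu (leq_gtF (mi : (m <= i)%N)); apply.
by move: im' ii; rewrite !addSn addnS !ltnS eqSS leq_eqVlt => /orP[/eqP ->|//];
  rewrite eqxx.
Qed.

End InnerOrFiniteRank.

(** * Scalars in orders of matrix algebras *)
Lemma unit_rows_exist (K : fieldType) (N : nat) (H : set 'rV[K]_N) :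
  (forall v : 'cV_N, (forall h, H h -> h *m v = 0) -> v = 0) ->
  exists2 B : 'M_N, (forall i, H (row i B)) & B \in unitmx.
Proof.
move=> Hv.
suff /(_ N (leqnn N))[B HB Bfree] : forall m, (m <= N)%N ->
    exists2 B : 'M_(m, N), (forall i, H (row i B)) & row_free B.
  by exists B => //; rewrite -row_free_unit.
elim=> [_|m IHm mN]; first by exists 0 => [[]//|]; rewrite -row_leq_rank.
have [B HB Bfree] := IHm (ltnW mN).
(* A nonzero vector killed by the rows chosen so far calls for a new row. *)
have [j vj] : exists j, col j (cokermx B) != 0.
  apply/existsP; rewrite -negb_forall; apply/negP => /forallP c0.
  have : \rank (cokermx B) = 0%N.
    apply/eqP; rewrite mxrank_eq0; apply/eqP/matrixP => i j.
    by have /eqP/matrixP/(_ i 0) := c0 j; rewrite !mxE.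
  rewrite mxrank_coker; move/eqP; rewrite subn_eq0 (eqP Bfree).
  by rewrite leqNgt mN.
set v := col j _ in vj.
have Bv : B *m v = 0 by rewrite /v colE mulmxA mulmx_coker mul0mx.
have [h Hh hv] : exists2 h, H h & h *m v != 0.
  apply: contrapT => nh; case/eqP: vj; apply: Hv => h Hh.
  by apply: contrapT => /eqP hv; apply: nh; exists h.
change (exists2 B' : 'M_(1 + m, N),
  (forall i : 'I_(1 + m), H (row i B')) & row_free B').
exists (col_mx h B) => [i|].
  case: (split_ordP i) => i' ->; last by rewrite rowKd.
  by rewrite rowKu (ord1 i') row_id.
apply: inj_row_free => u.
rewrite -[u](@hsubmxK _ 1 1 m) mul_row_col.
set u1 := lsubmx _; set u2 := rsubmx _ => uhB.
have u10 : u1 = 0.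
  have := congr1 (fun w => w *m v) uhB.
  rewrite mulmxDl -!mulmxA Bv mulmx0 addr0 mul0mx.
  rewrite [h *m v]mx11_scalar mul_mx_scalar => /eqP; rewrite scaler_eq0.
  case/orP => [/eqP hv0|/eqP //]; case/eqP: hv.
  by rewrite [h *m v]mx11_scalar hv0 raddf0.
move: uhB; rewrite u10 mul0mx add0r => uB.
by rewrite (row_free_inj Bfree (_ : u2 *m B = 0 *m B)) ?mul0mx // row_mx0.
Qed.

(** [E] is an additive and multiplicative subgroup of a matrix algebra, spanning it
over [K] and without zero divisors, like the Hamilton quaternions
with even integer coefficients among the two by two matrices over [Q(i)].  It
need not be a module over any subfield of [K]. *)
Section ScalarsInOrders.
Variables (K : fieldType) (k : nat) (E : set 'M[K]_k.+1).
Hypotheses (E0 : E 0) (EB : forall x y, E x -> E y -> E (x - y)).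
Hypothesis EM : forall x y, E x -> E y -> E (x * y).
Hypothesis Eunit : forall x, E x -> x != 0 -> x \in unitmx.
Hypothesis Espan : forall P : set 'M[K]_k.+1, P 0 ->
  (forall x y, P x -> P y -> P (x + y)) -> (forall a x, P x -> P (a *: x)) ->
  E `<=` P -> forall x, P x.

Let N := (k.+1 * k.+1)%N.

Lemma delta_mx_mul (A B : 'M[K]_k.+1) p q i j :
  (A *m delta_mx p q *m B) i j = A i p * B q j.
Proof.
rewrite -mulmxA mxE (bigD1 p) //= big1 ?addr0 => [|l lp].
  by rewrite mxE (bigD1 q) //= !mxE !eqxx mul1r big1 ?addr0 // => l lq;
    rewrite mxE (negbTE lq) andbF mul0r.
by rewrite mxE big1 ?mulr0 // => m _; rewrite mxE (negbTE lp) mul0r.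
Qed.

(** Among the nonzero linear maps preserving [E] take one, [F], of minimal rank,
and let [X] be a nonzero value of it in [E].  For [a] in [E] the map
[z |-> X a z - z a X] preserves [E] and kills [X], so its composite with [F] has
smaller rank and vanishes: [X a Y = Y a X] for all values [Y] of [F] and, by
linearity, all matrices [a].  Taking matrix units for [a] shows that [Y] is a
multiple of [X]. *)
Lemma rank_one_map : exists (X : 'M[K]_k.+1) (l : 'M[K]_k.+1 -> K),
  [/\ E X, X != 0, (exists x, l x != 0),
      (forall a x y, l (a *: x + y) = a * l x + l y) & forall x, E x -> E (l x
        *: X)].
Proof.
pose app (F : 'M[K]_N) x : 'M[K]_k.+1 := vec_mx (mxvec x *m F).
have appL F a x y : app F (a *: x + y) = a *: app F x + app F y.
  by rewrite /app linearP mulmxDl -scalemxAl linearP.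
have app0 F : app F 0 = 0 by rewrite /app linear0 mul0mx linear0.
have appD F x y : app F (x + y) = app F x + app F y.
  by have := appL F 1 x y; rewrite !scale1r.
have appZ F a x : app F (a *: x) = a *: app F x.
  by have := appL F a x 0; rewrite app0 !addr0.
have appeq0 F : (forall x, app F x = 0) -> F = 0.
  move=> F0; apply/row_matrixP => i; rewrite row0 rowE.
  by have := congr1 mxvec (F0 (vec_mx (delta_mx 0 i)));
    rewrite /app !vec_mxK linear0.
pose pres F := forall x, E x -> E (app F x).
have exr : exists r, `[< exists F : 'M[K]_N, [/\ F != 0, pres F & \rank F = r] >].
  exists (\rank (1%:M : 'M[K]_N)); apply/asboolP; exists 1%:M; split=> //.
    by rewrite -mxrank_eq0 mxrank1.
  by move=> x Ex; rewrite /app mulmx1 mxvecK.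
case: (ex_minnP exr) => r /asboolP[F [F0 presF rF]] minr.
have [x0 Ex0 Fx0] : exists2 x, E x & app F x != 0.
  apply: contrapT => h; case/eqP: F0; apply: appeq0.
  apply: Espan => [||a x|x Ex]; rewrite ?app0 //.
  - by move=> x y; rewrite appD => -> ->; rewrite addr0.
  - by rewrite appZ => ->; rewrite scaler0.
  - by apply: contrapT => /eqP Fx; apply: h; exists x.
set X := app F x0 in Fx0; have EX : E X by apply: presF.
have comm y a : X *m a *m app F y = app F y *m a *m X.
  move: a; apply: Espan => [||c x|a Ea].
  - by rewrite !(mulmx0, mul0mx).
  - by move=> a b ha hb; rewrite !(mulmxDr, mulmxDl) ha hb.
  - by rewrite -!(scalemxAr, scalemxAl) => ->.
  pose G := lin_mulmx (X *m a) - lin_mulmxr (a *m X).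
  have GE z : mxvec z *m G = mxvec (X *m a *m z - z *m a *m X).
    by rewrite mulmxBr !mul_vec_lin linearB /= mulmxA.
  have appFG z : app (F *m G) z = X *m a *m app F z - app F z *m a *m X.
    rewrite /app mulmxA -{1}[mxvec z *m F]vec_mxK GE mxvecK.
    by [].
  suff FG : F *m G = 0.
    by apply/eqP; rewrite -subr_eq0 -appFG FG /app mulmx0 linear0.
  apply: contrapT => /eqP FG.
  have : (r <= \rank (F *m G))%N.
    apply: minr; apply/asboolP; exists (F *m G); split=> // x Ex; rewrite appFG.
    by apply: EB; do 2?[apply: EM] => //; apply: presF.
  rewrite -rF -(mxrank_mul_ker F G) -[leqRHS]addn0 leq_add2l leqn0 mxrank_eq0.
  move=> /eqP cap0; case/eqP: Fx0.
  have : (mxvec X <= F :&: kermx G)%MS.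
    rewrite sub_capmx; apply/andP; split.
      by rewrite /X /app vec_mxK submxMl.
    apply/sub_kermxP; rewrite GE.
    by rewrite -mulmxA subrr linear0.
  by rewrite cap0 submx0 mxvec_eq0 => /eqP.
have [i0 [j0 Xij]] : exists i0 j0, X i0 j0 != 0.
  apply: contrapT => h; case/eqP: Fx0; apply/matrixP => i j; rewrite [RHS]mxE.
  by apply: contrapT => /eqP Xij; apply: h; exists i, j.
exists X, (fun y => app F y i0 j0 / X i0 j0); split=> //.
- by exists x0; rewrite divff ?oner_eq0.
- by move=> a x y; rewrite appL !mxE mulrDl mulrA.
move=> x /presF; congr E; apply/matrixP => i p; rewrite [RHS]mxE.
have := congr1 (fun M : 'M_k.+1 => M i j0) (comm x (delta_mx p i0)).
rewrite !delta_mx_mul => h; apply: (mulIf Xij).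
by rewrite -h [RHS]mulrAC divfK // mulrC.
Qed.

(** Cramer's rule.  The values of [l] on [E] need not be in [E], but multiplied by
[X] they send [E] into [E]; [J m] collects the scalars with that property for
[X ^+ m], such as the products of [m] values of [l].  Choose a basis [e_j] in
[X ^+ N E], and [N] independent functionals [z |-> l (a z b)] with [a], [b] in
[E].  Their matrix [B] on the basis has entries in [l E], and so has the column
of their values at the identity.  The coordinates of the identity, multiplied
by [\det B], are then sums of products of [N] values of [l], and so
[\det B] is the scalar sought. *)
Lemma scalar_in_order : exists2 a : K, a != 0 & E a%:M.
Proof.
have [X [l [EX X0 [x1 lx1] lL lE]]] := rank_one_map.
have l0 : l 0 = 0.
  by have := lL 1 0 0; rewrite scaler0 add0r mul1r => /(congr1 (fun z => z - l
    0)); rewrite addrK subrr.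
have lD x y : l (x + y) = l x + l y by have := lL 1 x y; rewrite scale1r mul1r.
have lZ a x : l (a *: x) = a * l x by have := lL a x 0; rewrite l0 !addr0.
have Xu : X \in unitmx by apply: Eunit.
have EN x : E x -> E (- x) by move=> Ex; rewrite -sub0r; apply: EB.
have ED x y : E x -> E y -> E (x + y).
  by move=> Ex Ey; rewrite -[y]opprK; apply/EB/EN.
have EXn m y : E y -> E (X ^+ m * y).
  by move=> Ey; elim: m => [|m IHm]; rewrite ?mul1r // exprS -mulrA; apply: EM.
have Xmu m : X ^+ m \is a GRing.unit by rewrite unitrX.
pose J m (c : K) := forall y, E y -> E (c *: (X ^+ m * y)).
have J0 m : J m 0 by move=> y Ey; rewrite scale0r.
have JD m a b : J m a -> J m b -> J m (a + b).
  by move=> Ja Jb y Ey; rewrite scalerDl; apply: ED; [apply: Ja|apply: Jb].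
have JN m a : J m a -> J m (- a).
  by move=> Ja y Ey; rewrite scaleNr; apply: EN; apply: Ja.
have JM m1 m2 a b : J m1 a -> J m2 b -> J (m1 + m2)%N (a * b).
  move=> Ja Jb y Ey; have := Ja _ (Jb y Ey); congr E.
  by rewrite -scalerAr scalerA mulrA exprD.
have Jl x : E x -> J 1%N (l x).
  by move=> Ex y Ey; rewrite expr1 scalerAl; apply: EM => //; apply: lE.
have Jprod m (F : 'I_m -> K) : (forall i, J 1%N (F i)) -> J m (\prod_i F i).
  elim: m F => [|m IHm] F JF.
    by rewrite big_ord0 => y Ey; rewrite mul1r scale1r.
  by rewrite big_ord_recl; apply: (JM 1%N m) => //; apply: IHm => i.
have Jsign m b (c : K) : J m c -> J m ((-1) ^+ b * c).
  by elim: b => [|b IHb] Jc; rewrite ?mul1r // exprS -mulrA mulN1r; apply/JN/IHb.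
have Jdet m (M : 'M[K]_m) : (forall i j, J 1%N (M i j)) -> J m (\det M).
  move=> JMij; rewrite /determinant; elim/big_ind: _ => // [a b|s _];
    first exact: JD.
  by apply: Jsign; apply: Jprod.
have [B0 B0E B0u] : exists2 B : 'M[K]_N,
    (forall i, [set mxvec x | x in E] (row i B)) & B \in unitmx.
  apply: unit_rows_exist => v Hv.
  have : forall x, mxvec x *m v = 0.
    apply: Espan => [||a x|x Ex]; rewrite ?linear0 ?mul0mx //.
    - by move=> x y hx hy; rewrite linearD mulmxDl hx hy addr0.
    - by move=> hx; rewrite linearZ -scalemxAl hx scaler0.
    - by apply: Hv; exists x.
  move=> h; apply/row_matrixP => i; rewrite row0 rowE.
  by have := h (vec_mx (delta_mx 0 i)); rewrite vec_mxK.
(* The factor [X ^+ N] absorbs [N] values of [l]. *)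
pose e j := X ^+ N * vec_mx (row j B0).
have B0rowE j : E (vec_mx (row j B0)).
  by have [x Ex <-] := B0E j; rewrite mxvecK.
have Ee j : E (e j) by apply: EXn.
have esum (v : 'cV[K]_N) : \sum_j v j 0 *: e j = X ^+ N * vec_mx (v^T *m B0).
  rewrite mulmx_sum_row linear_sum mulr_sumr; apply: eq_bigr => j _.
  by rewrite linearZ /= !mxE scalerAr.
have efree (v : 'cV[K]_N) : \sum_j v j 0 *: e j = 0 -> v = 0.
  rewrite esum => /(congr1 ( *%R (X ^- N))); rewrite mulKr // mulr0.
  move=> /(congr1 mxvec); rewrite vec_mxK linear0.
  move=> /(congr1 (mulmx^~ (invmx B0))); rewrite mulmxK // mul0mx.
  by move=> /(congr1 trmx); rewrite trmxK trmx0.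
have [B BE Bu] : exists2 B : 'M[K]_N,
    (forall i, [set h | exists a b, [/\ E a, E b & h = \row_j l (a * e j * b)]]
       (row i B)) & B \in unitmx.
  apply: unit_rows_exist => v Hv; apply: efree; set z := \sum_j _.
  have lz0 : forall a b, l (a * z * b) = 0.
    move=> a; apply: Espan => [||c x|b Eb]; rewrite ?mulr0 //.
    - by move=> x y hx hy; rewrite mulrDr lD hx hy addr0.
    - by rewrite -scalerAr lZ => ->; rewrite mulr0.
    move: a; apply: Espan => [||c x|a Ea]; rewrite ?mul0r //.
    - by move=> x y hx hy; rewrite !mulrDl lD hx hy addr0.
    - by rewrite -!scalerAl lZ => ->; rewrite mulr0.
    have := Hv (\row_j l (a * e j * b)).
    move=> /(_ (ex_intro _ a (ex_intro _ b (And3 Ea Eb erefl)))).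
    move=> /(congr1 (fun M : 'M_1 => M 0 0)); rewrite !mxE => h; rewrite -[RHS]h.
    rewrite /z mulr_sumr mulr_suml.
    rewrite (big_morph l lD l0); apply: eq_bigr => j _.
    by rewrite mxE -scalerAr -scalerAl lZ mulrC.
  apply/matrixP => p q; rewrite [RHS]mxE; apply: contrapT => /eqP zpq.
  case/eqP: lx1; rewrite (matrix_sum_delta x1) (big_morph l lD l0) big1 // => i _.
  rewrite (big_morph l lD l0) big1 // => j _; rewrite lZ.
  suff -> : l (delta_mx i j) = 0 by rewrite mulr0.
  apply: (mulfI zpq); rewrite mulr0 -lZ -[RHS](lz0 (delta_mx i p) (delta_mx q j)).
  congr l; apply/matrixP => i' j'; rewrite !mxE (bigD1 q) //= !mxE.
  rewrite (bigD1 p) //= !mxE !eqxx !andbT /=.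
  rewrite big1 => [|m mp]; last by rewrite mxE (negbTE mp) andbF mul0r.
  rewrite big1 => [|m mq]; last by rewrite !mxE (negbTE mq) mulr0.
  by rewrite ?addr0 -mulnb natrM mulrA [_%:R * z p q]mulrC.
have JB i j : J 1%N (B i j).
  have [a [b [Ea Eb /matrixP/(_ 0 j)]]] := BE i; rewrite !mxE => ->.
  by apply: Jl; apply: EM => //; apply: EM.
(* The coordinates of the identity in the basis [e_j]. *)
pose xi : 'cV[K]_N := (mxvec (X ^- N) *m invmx B0)^T.
have xiE : \sum_j xi j 0 *: e j = 1.
  by rewrite esum trmxK mulmxKV // mxvecK mulrV.
have Jxi i : J 1%N ((B *m xi) i 0).
  have [a [b [Ea Eb /rowP Bi]]] := BE i.
  suff -> : (B *m xi) i 0 = l (a * b) by apply: Jl; apply: EM.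
  have -> : a * b = \sum_j xi j 0 *: (a * e j * b).
    rewrite -{1}[a]mulr1 -xiE mulr_sumr mulr_suml; apply: eq_bigr => j _.
    by rewrite -scalerAr -scalerAl.
  rewrite mxE (big_morph l lD l0); apply: eq_bigr => j _.
  by have := Bi j; rewrite !mxE lZ mulrC => ->.
exists (\det B); first by rewrite -unitfE -unitmxE.
have detxi j : \det B * xi j 0 = \sum_p \adj B j p * (B *m xi) p 0.
  have := congr1 (fun M => M *m xi) (mul_adj_mx B).
  rewrite mul_scalar_mx => /matrixP/(_ j 0); rewrite [RHS]mxE => <-.
  by rewrite -mulmxA mxE.
rewrite -scalemx1 -[1%:M]/(1 : 'M_k.+1) -xiE scaler_sumr.
elim/big_ind: _ => // j _.
rewrite scalerA detxi /e.
have EJ : forall (c : K) y, J N c -> E y -> E (c *: (X ^+ N * y)) by move=> c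
  y; apply.
apply: EJ => //; elim/big_ind: _ => // [a b|p _]; first exact: JD.
rewrite (_ : J N = J (N.-1 + 1)%N); last by rewrite addn1.
apply: JM => //.
rewrite mxE /cofactor; apply: Jsign; apply: Jdet => i' j'.
by rewrite !mxE.
Qed.

End ScalarsInOrders.

(** * Elements of minimal rank *)
Section Independence.
Variables (K : fieldType) (V : lmodType K).
Implicit Types (q b : nat -> V).

Lemma indep_leq m k b q : indep m b ->
  (forall i, (i < m)%N -> inspan k q (b i)) -> (m <= k)%N.
Proof.
move=> bi bq; rewrite leqNgt; apply/negP => km.
have /choice[mu hmu] : forall i : 'I_m, exists mu : nat -> K,
    b i = \sum_(j < k) mu j *: q j by move=> i; apply: bq.
pose M : 'M[K]_(m, k) := \matrix_(i, j) mu i j.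
have : kermx M != 0.
  rewrite kermx_eq0 /row_free; apply: contraTneq km => <-.
  by rewrite -leqNgt rank_leq_col.
case/rowV0Pn => v /sub_kermxP vM; case/eqP; apply/rowP => i; rewrite [RHS]mxE.
pose nu j := if insub j is Some j' then v 0 j' else 0.
have nuE (j : 'I_m) : nu j = v 0 j by rewrite /nu insubT // => ?;
  congr (v 0 _); apply: val_inj.
rewrite -nuE; apply: bi (ltn_ord i).
rewrite (eq_bigr (fun j : 'I_m => \sum_(l < k) (v 0 j * M j l) *: q l)); last first.
  move=> j _; rewrite nuE hmu scaler_sumr; apply: eq_bigr => l _.
  by rewrite scalerA mxE.
rewrite exchange_big big1 // => l _; rewrite -scaler_suml.
by have /rowP/(_ l) := vM; rewrite !mxE => ->; rewrite scale0r.
Qed.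

Lemma inspan_drop k q mu j : (j < k.+1)%N -> mu j = 0 ->
  inspan k (fun i => q (bump j i)) (\sum_(i < k.+1) mu i *: q i).
Proof.
move=> jk muj; exists (fun i => mu (bump j i)).
by rewrite (bigD1_ord (Ordinal jk)) //= muj scale0r add0r.
Qed.

End Independence.

Section MinimalRank.
Variables (K : fieldType) (V : lmodType K) (R : rngType) (rho : R -> endo V).
Variable d : R -> R.
Hypotheses (rhoM : rng_morphism rho) (rhoK : forall r, klin (rho r)).
Hypotheses (dD : derivation rmul d).
Hypotheses (irr : irreducible_module rho) (cent : scalar_centralizer rho).

(** The vectors killed by [x] and by all the [x * rho r] form a submodule; if
[y <> 0], it contains the nonzero vectors of the form [rho r (y v)]. *)
Lemma prime_action (x y : endo V) : klin x ->
  (forall r, x * rho r * y = 0) -> x = 0 \/ y = 0.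
Proof.
move=> xK xy; have [->|/eqP y0] := eqVneq y 0; [by right|left].
have [v yv] : exists v, y v <> 0.
  by apply: contrapT => /forallNP h; apply: y0; apply: endoP => v; apply: contrapT.
have xry r : x (rho r (y v)) = 0 by rewrite -!endo_mulE xy.
have [r ryv] := nonzero_action rhoM rhoK irr yv.
apply: endoP => w; suff [] : x w = 0 /\ forall r, x (rho r w) = 0 by [].
move: w; apply: irr.2; last first.
  exists (rho r (y v)) => //; split=> [|s] //.
  by rewrite -[rho s _]endo_mulE -(rngM rhoM).
split=> [|u w [u0 ur] [w0 wr]|k w [w0 wr]|s w [w0 wr]].
- by split=> [|s]; rewrite !endo0.
- by split=> [|s]; rewrite !endoD ?u0 ?w0 ?ur ?wr addr0.
- by split=> [|s]; rewrite ?rhoK xK ?w0 ?wr scaler0.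
- by split=> [|t] //; rewrite -[rho t _]endo_mulE -(rngM rhoM).
Qed.

Lemma irreducible_semiprime : semiprime_kernel rho.
Proof. by move=> a /(prime_action (rhoK a))[]. Qed.

Definition minimal_rank (c : R) (k : nat) : Prop :=
  [/\ rho c <> 0, (exists q, range (rho c) `<=` inspan k q) &
      forall r m q, rho r <> 0 -> range (rho r) `<=` inspan m q -> (k <= m)%N].

Lemma minimal_rank_exists r : rho r <> 0 -> finrank (rho r) ->
  exists c k, minimal_rank c k.
Proof.
move=> r0 [m [q rq]].
have exk : exists k, `[< exists c, rho c <> 0 /\ exists q, range (rho c) `<=`
  inspan k q >].
  by exists m; apply/asboolP; exists r; split=> //; exists q.
case: (ex_minnP exk) => k /asboolP[c [c0 cq]] mink.
exists c, k; split=> // s m' q' s0 sq; apply: mink; apply/asboolP.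
by exists s; split=> //; exists q'.
Qed.

Variables (c : R) (k : nat).
Hypothesis cmin : minimal_rank c k.
Local Notation C := (rho c).

(** If [y] kills a nonzero vector of the image of [c], it makes the spanning family
of that image dependent, and [y c] has smaller rank. *)
Lemma minimal_rank_inj y v : rho y (C v) = 0 -> C v <> 0 -> rho y * C = 0.
Proof.
move=> yCv Cv; have [c0 [q cq] mink] := cmin.
have [mu muE] : inspan k q (C v) by apply: cq; exists v.
have [j jk muj] : exists2 j, (j < k)%N & mu j != 0.
  apply: contrapT => h; apply: Cv; rewrite muE big1 // => i _.
  suff -> : mu i = 0 by rewrite scale0r.
  by apply: contrapT => /eqP mui; apply: h; exists i.
apply: contrapT => yC.
case: k jk cq mink muE => // k' jk cq mink muE.
have := mink (y ** c) k' (fun i => rho y (q (bump j i))).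
rewrite ltnn => h; suff : false by []; apply: h; first by rewrite (rngM rhoM).
move=> _ [w _ <-]; rewrite (rngM rhoM) endo_mulE.
have [nu nuE] : inspan k'.+1 q (C w) by apply: cq; exists w.
(* Subtracting a vector that [y] kills removes the coordinate [j]. *)
have -> : rho y (C w) = rho y (C w - (nu j / mu j) *: C v).
  by rewrite endoB rhoK yCv scaler0 subr0.
have -> : C w - (nu j / mu j) *: C v =
    \sum_(i < k'.+1) (nu i - nu j / mu j * mu i) *: q i.
  rewrite nuE muE scaler_sumr -sumrB; apply: eq_bigr => i _.
  by rewrite scalerBl scalerA.
have muj0 : nu j - nu j / mu j * mu j = 0 by rewrite divfK // subrr.
have [xi ->] := inspan_drop (mu := fun i => nu i - nu j / mu j * mu i) q jk muj0.
by exists xi; rewrite endo_sumr; apply: eq_bigr => i _; rewrite rhoK.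
Qed.

Lemma minimal_rank_basis : exists u : nat -> V,
  indep k (fun i => C (u i)) /\ range C `<=` inspan k (fun i => C (u i)).
Proof.
have [c0 [q cq] mink] := cmin.
have exm : exists m, `[< exists u : nat -> V, indep m (fun i => C (u i)) >].
  by exists 0%N; apply/asboolP; exists (fun=> 0) => mu _ [].
have bound m : `[< exists u : nat -> V, indep m (fun i => C (u i)) >] -> (m <= k)%N.
  by move=> /asboolP[u ui]; apply: indep_leq ui _ => i _; apply: cq; exists (u i).
case: (ex_maxnP exm bound) => m mP maxm.
have mk := bound _ mP; case/asboolP: mP => u ui.
have Cspan : range C `<=` inspan m (fun i => C (u i)).
  move=> _ [v _ <-]; apply: contrapT => vn.
  suff : (m.+1 <= m)%N by rewrite ltnn.
  apply: maxm; apply/asboolP; exists (fun i => if i == m then v else u i).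
  have := indep_extend ui vn; congr indep; apply/funext => i.
  by case: ifP.
have km : (k <= m)%N by apply: mink c0 Cspan.
suff -> : k = m by exists u.
by apply/eqP; rewrite eqn_leq km mk.
Qed.

(** On a basis [b_j = C (u j)] of the image of [c], the operator [c s] has a matrix
[M s].  The set of these matrices satisfies the hypotheses of
[scalar_in_order]: its nonzero elements are invertible by minimality of the
rank, and it spans all matrices by density. *)
Lemma minimal_rank_scalar :
  exists r (a : K), a != 0 /\ forall v, C (rho r (C v)) = a *: C v.
Proof.
have [c0 _ _] := cmin; have [u] := minimal_rank_basis.
case: k => [|k'] [bi bspan].
  exfalso; apply: c0; apply: endoP => v.
  by have [|mu] := bspan (C v); [exists v|rewrite big_ord0].
set b := (fun i => _) in bi bspan.
pose act (Z : 'M[K]_k'.+1) (j : 'I_k'.+1) := \sum_i Z i j *: b i.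
have actP Z Z' : (forall j, act Z j = act Z' j) -> Z = Z'.
  move=> ZZ; apply/matrixP => i j; apply/eqP; rewrite -subr_eq0; apply/eqP.
  have := bi (fun i => Z (inord i) j - Z' (inord i) j) _ i (ltn_ord i).
  rewrite inord_val; apply.
  rewrite -[RHS](subrr (act Z j)) {2}ZZ -sumrB; apply: eq_bigr => l _.
  by rewrite inord_val scalerBl.
have actD Z Z' j : act (Z + Z') j = act Z j + act Z' j.
  by rewrite -big_split; apply: eq_bigr => i _; rewrite mxE scalerDl.
have actZ a Z j : act (a *: Z) j = a *: act Z j.
  by rewrite scaler_sumr; apply: eq_bigr => i _; rewrite mxE scalerA.
have act0 j : act 0 j = 0.
  by rewrite /act big1 // => i _; rewrite mxE scale0r.
have actM Z Z' j : act (Z * Z') j = \sum_l Z' l j *: act Z l.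
  rewrite /act; under [RHS]eq_bigr do rewrite scaler_sumr.
  rewrite exchange_big; apply: eq_bigr => i _; rewrite mxE scaler_suml.
  by apply: eq_bigr => l _; rewrite scalerA mulrC.
have /choice[M hM] : forall s, exists Z, forall j : 'I_k'.+1, act Z j = C (rho
  s (b j)).
  move=> s; have /choice[mu hmu] : forall j : 'I_k'.+1, exists mu : nat -> K,
      C (rho s (b j)) = \sum_(i < k'.+1) mu i *: b i.
    by move=> j; apply: bspan; exists (rho s (b j)).
  exists (\matrix_(i, j) mu j i) => j; rewrite hmu.
  by apply: eq_bigr => i _; rewrite mxE.
have [||||P P0 PD PZ MP Z|a a0 [r _ rE]] := @scalar_in_order K k' (range M).
- exists 0 => //; apply: actP => j; rewrite hM act0 (rng0 rhoM).
  by rewrite endo_zeroE endo0.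
- move=> _ _ [s _ <-] [t _ <-]; exists (s - t) => //; apply: actP => j.
  by rewrite hM (rngB rhoM) -scaleN1r actD actZ !hM endo_subE endoB scaleN1r.
- move=> _ _ [s _ <-] [t _ <-]; exists (s ** c ** t) => //; apply: actP => j.
  rewrite hM actM (eq_bigr (fun l => M t l j *: C (rho s (b l)))) => [|l _];
    last by rewrite hM.
  rewrite !(rngM rhoM) !endo_mulE -[C (rho t _)]hM /act !endo_sumr.
  by apply: eq_bigr => l _; rewrite !rhoK.
- move=> _ [s _ <-] Ms; rewrite -unitmx_tr -row_free_unit.
  apply: inj_row_free => v vM.
  pose w := \sum_(j < k'.+1) v 0 j *: u j.
  have Cw : C w = \sum_(j < k'.+1) v 0 j *: b j.
    by rewrite endo_sumr; apply: eq_bigr => j _; rewrite rhoK.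
  have csw : rho (c ** s) (C w) = 0.
    rewrite Cw endo_sumr (eq_bigr (fun j => v 0 j *: act (M s) j)) => [|j _];
      last first.
      by rewrite rhoK (rngM rhoM) endo_mulE hM.
    under eq_bigr do rewrite scaler_sumr.
    rewrite exchange_big big1 // => i _.
    rewrite (eq_bigr (fun j => (v 0 j * (M s)^T j i) *: b i)) => [|j _];
      last by rewrite scalerA mxE.
    by rewrite -scaler_suml; have /rowP/(_ i) := vM; rewrite !mxE => ->;
      rewrite scale0r.
  have Cw0 : C w = 0.
    apply: contrapT => /(minimal_rank_inj csw) h; case/eqP: Ms; apply: actP => j.
    rewrite hM act0; have := congr1 (fun T : endo V => T (u j)) h.
    by rewrite (rngM rhoM) !endo_mulE.
  apply/rowP => j; rewrite [RHS]mxE.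
  have := bi (fun i => v 0 (inord i)) _ j (ltn_ord j); rewrite inord_val; apply.
  by rewrite -[RHS]Cw0 Cw; apply: eq_bigr => i _; rewrite inord_val.
- have dP A : dspan rho d A -> exists2 Z', P Z' & forall j : 'I_k'.+1, act Z' j
    = C (A.1 (b j)).
    elim=> [s|A1 A2 _ [Z1 PZ1 h1] _ [Z2 PZ2 h2]|a A1 _ [Z1 PZ1 h1]].
    + by exists (M s) => //; apply: MP; exists s.
    + by exists (Z1 + Z2) => [|j]; [apply: PD|rewrite actD h1 h2 endo_addE endoD].
    + exists (a *: Z1) => [|j]; first exact: PZ.
      by rewrite actZ h1 wscale1E rhoK.
  pose w j := \sum_(i < k'.+1) Z i (inord j) *: u i.
  have [A [hA Aw]] := density rhoM rhoK dD irr cent bi w.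
  have [Z' PZ' hZ'] := dP A hA.
  suff -> : Z = Z' by [].
  apply: actP => j; rewrite hZ' Aw ?ltn_ord // /w endo_sumr inord_val.
  by apply: eq_bigr => i _; rewrite rhoK.
- exists r, a; split=> // v.
  have [mu ->] : inspan k'.+1 b (C v) by apply: bspan; exists v.
  rewrite !endo_sumr scaler_sumr; apply: eq_bigr => i _; rewrite !rhoK.
  rewrite -hM rE /act (bigD1 i) //= mxE eqxx big1 ?addr0.
    by rewrite !scalerA mulrC.
  by move=> l li; rewrite mxE (negbTE li) scale0r.
Qed.

End MinimalRank.

(** * Derivations of dense rings *)
Section DenseModules.
Variables (K : fieldType) (V : lmodType K) (R : rngType).
Variables (rho : R -> endo V) (d : R -> R) (n : nat).
Hypotheses (rhoM : rng_morphism rho) (rhoK : forall r, klin (rho r)).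
Hypotheses (dD : derivation rmul d) (n_gt0 : (0 < n)%N).
Hypothesis dn : forall x y,
  rho (d (x ** y)) ^+ n = rho (d x) ^+ n * rho (d y) ^+ n.
Hypotheses (irr : irreducible_module rho) (cent : scalar_centralizer rho).

Local Notation D x := (rho (d x)).
Local Notation s_ a := (scalar_endo V a).

Let rhosp := irreducible_semiprime rhoM rhoK irr.
Let rule := mul_zero_derivation rhoM rhosp dD n_gt0 dn.
Let DM := rho_dM rhoM dD.

Lemma scalarM a b : s_ a * s_ b = s_ (a * b).
Proof. by apply: endoP => v; rewrite endo_mulE /= scalerA. Qed.

Lemma scalar_eq0 a x : a != 0 -> s_ a * x = 0 -> x = 0.
Proof.
move=> a0 ax; apply: endoP => v; apply: (scalerI a0).
by have := congr1 (fun T : endo V => T v) ax; rewrite endo_mulE /= scaler0.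
Qed.

Lemma rngM3 x y z : rho (x ** y ** z) = rho x * rho y * rho z.
Proof. by rewrite !(rngM rhoM). Qed.

(** The scalar [a] is not in [R], so the zero product [(a q - q e) e] is formed for
[q = e y], where [a q = e e y].  The rule for zero products gives
[e y (a e' - e e') = 0] for all [y], and primeness concludes. *)
Lemma scaled_idempotent_derivation e a : rho e <> 0 ->
  rho e * rho e = s_ a * rho e ->
  rho e * D e = s_ a * D e /\ D e * rho e = s_ a * D e.
Proof.
move=> e0 ee; set E := rho e in e0 ee *.
have aC r : rho r * s_ a = s_ a * rho r by rewrite klin_comm.
split; apply/eqP; rewrite eq_sym -subr_eq0; apply/eqP.
  suff h y : E * rho y * (s_ a * D e - E * D e) = 0.
    by have [/e0|] := prime_action rhoM rhoK irr (rhoK e) h.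
  set s := e ** e ** y - e ** y ** e.
  have sE : rho s = s_ a * (E * rho y) - E * rho y * E.
    by rewrite (rngB rhoM) !rngM3 ee !mulrA.
  have aEy : E * rho y * s_ a = s_ a * (E * rho y) by rewrite -(rngM rhoM) aC.
  have [|h _] := @rule s e.
    by rewrite sE mulrBl -[E * _ * E * _]mulrA ee !mulrA aEy !mulrA subrr.
  move: h; rewrite sE mulrBl => h; rewrite mulrBr -[RHS]h.
  by congr (_ - _); rewrite !mulrA // aEy !mulrA.
suff h y : (s_ a * D e - D e * E) * rho y * E = 0.
  have WK : klin (s_ a * D e - D e * E).
    apply: klinD; first by apply: klinM; [apply: klin_scalar|].
    by apply: klinN; apply: klinM; apply: rhoK.
  by have [|/e0] := prime_action rhoM rhoK irr WK h.
set s := y ** e ** e - e ** y ** e.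
have sE : rho s = s_ a * rho y * E - E * rho y * E.
  by rewrite (rngB rhoM) !rngM3 -/E -[_ * E * E]mulrA ee !mulrA aC.
have [|_ h] := @rule e s.
  by rewrite sE mulrBr !mulrA -/E ee aC subrr.
by move: h; rewrite sE mulrBr !mulrA klin_comm // -!mulrBl.
Qed.

Lemma power_derivation e a m : rho e <> 0 -> rho e * rho e = s_ a * rho e ->
  rho (rpow e m.+1) = s_ (a ^+ m) * rho e /\
  D (rpow e m.+1) = s_ (m.+1%:R * a ^+ m) * D e.
Proof.
move=> e0 ee; have [eD De] := scaled_idempotent_derivation e0 ee.
elim: m => [|m [IHe IHd]].
  rewrite expr0 mulr1 /=; split; apply: endoP => v; rewrite endo_mulE /= scale1r //.
rewrite rpowS (rngM rhoM) DM IHe IHd; split.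
  by rewrite mulrA klin_comm // -mulrA ee mulrA scalarM exprSr.
rewrite !mulrA !klin_comm // -!mulrA De eD !mulrA !scalarM -mulrDl.
congr (_ * _); apply: endoP => v /=; rewrite -scalerDl; congr (_ *: _).
by rewrite -mulrA -!exprSr [m.+2%:R]mulrS mulrDl mul1r.
Qed.

Lemma power_map x m : D (rpow x m.+1) ^+ n = (D x ^+ n) ^+ m.+1.
Proof.
elim: m => [|m IHm]; first by rewrite expr1.
by rewrite rpowS dn IHm -exprS.
Qed.

Section MinimalRankElement.
Variables (c : R) (k : nat).
Hypothesis cmin : minimal_rank rho c k.
Local Notation C := (rho c).

Lemma minimal_rank_iter y m v : (forall w, exists w', rho y (C w) = C w') ->
  rho y * C <> 0 -> C v <> 0 -> (rho y ^+ m) (C v) <> 0.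
Proof.
move=> yC yC0; elim: m v => [|m IHm] v Cv; first by rewrite expr0.
rewrite exprSr endo_mulE; have [w yw] := yC v; rewrite yw; apply: IHm => Cw.
by apply: yC0; apply: (minimal_rank_inj rhoM rhoK cmin) Cv; rewrite yw.
Qed.

(** Let [e = c r] act as the scalar [a] on the image of [c], so that
[(e^k)' = k a^(k-1) e'].  If [e' <> 0], then [e'] is injective on that image.
For [k = 2] the power condition reads [(2 a)^n e'^n = e'^(2 n)], so [e'^n] acts
as [(2 a)^n] on the vector [u] below, and for [k = 3] it then gives
[3^n = 4^n] in [K].  So the integer [4^n - 3^n] is zero in [K], and may serve as
the exponent [k]. *)
Lemma constant_scaled_idempotent :
  exists g b, [/\ b != 0, rho g * rho g = s_ b * rho g, D g = 0,
    forall v, rho g (C v) = b *: C v & exists x, rho g = C * x].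
Proof.
have [c0 _ _] := cmin.
have [r [a [a0 hr]]] := minimal_rank_scalar rhoM rhoK dD irr cent cmin.
pose e := c ** r; have eE : rho e = C * rho r by rewrite (rngM rhoM).
have eC v : rho e (C v) = a *: C v by rewrite eE endo_mulE hr.
have ee : rho e * rho e = s_ a * rho e.
  by apply: endoP => v; rewrite !endo_mulE {2 3}eE !endo_mulE eC.
have [v Cv] : exists v, C v <> 0.
  by apply: contrapT => /forallNP h; apply: c0; apply: endoP => v; apply: contrapT.
have e0 : rho e <> 0.
  move=> e0; apply: Cv; apply: (scalerI a0); rewrite -eC e0.
  by rewrite endo_zeroE scaler0.
suff [m Dm] : exists m, D (rpow e m.+1) = 0.
  have [gE _] := power_derivation m e0 ee.
  exists (rpow e m.+1), (a ^+ m.+1); split=> //.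
  - by rewrite expf_neq0.
  - rewrite gE mulrA -[_ * rho e * _]mulrA klin_comm // mulrA -mulrA ee.
    by rewrite !mulrA !scalarM exprSr mulrAC.
  - by move=> w; rewrite gE endo_mulE eC /= scalerA exprSr.
  - exists (s_ (a ^+ m) * rho r); rewrite gE eE !mulrA; congr (_ * _).
    by rewrite klin_comm.
have [De0|/eqP De0] := eqVneq (D e) 0; first by exists 0%N.
have [eD De] := scaled_idempotent_derivation e0 ee.
have DC w : exists w', D e (C w) = C w'.
  exists (a^-1 *: rho r (D e (C w))); rewrite rhoK.
  rewrite -[C (rho r _)]endo_mulE -eE -[rho e _]endo_mulE eD.
  by rewrite endo_mulE /= scalerA mulVf // scale1r.
have DC0 : D e * C <> 0.
  move=> h; apply: De0; apply: (scalar_eq0 a0).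
  by rewrite -De eE mulrA h mul0r.
have pw m : s_ ((m.+1%:R * a ^+ m) ^+ n) * D e ^+ n = (D e ^+ n) ^+ m.+1.
  rewrite -power_map (power_derivation m e0 ee).2.
  rewrite [in RHS]exprMn_comm; last exact: (esym (klin_comm _ (rhoK _))).
  congr (_ * _); elim: n => [|l IHl]; last by rewrite !exprS -IHl scalarM.
  by rewrite !expr0; apply: endoP => w; rewrite /= scale1r.
have h1 := pw 1%N; have h2 := pw 2%N.
pose u := (D e ^+ n) (C v).
have u0 : u <> 0 by apply: minimal_rank_iter.
have Du : (D e ^+ n) u = (2%:R * a) ^+ n *: u.
  have := congr1 (fun T : endo V => T (C v)) h1.
  by rewrite expr1 expr2 !endo_mulE /= => <-.
have DDu : (D e ^+ n) ((D e ^+ n) u) = (3%:R * a ^+ 2) ^+ n *: u.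
  have := congr1 (fun T : endo V => T (C v)) h2.
  by rewrite [in RHS]exprS expr2 !endo_mulE /= => <-.
have DnK : klin (D e ^+ n).
  by elim: n => [|l IHl]; [exact: klin1|rewrite exprS; apply: klinM].
have : ((2 ^ n * 2 ^ n)%:R - (3 ^ n)%:R) * (a ^+ (n + n)) *: u = 0.
  rewrite mulrBl scalerBl; apply/eqP; rewrite subr_eq0; apply/eqP.
  rewrite natrM !natrX exprD.
  by move: DDu; rewrite Du DnK Du scalerA !exprMn => <-; rewrite mulrACA.
move/eqP; rewrite scaler_eq0 => /orP[|/eqP //].
rewrite mulf_eq0 [a ^+ _ == 0]expf_eq0 (negbTE a0) andbF orbF => char.
have lt34 : (3 ^ n < 2 ^ n * 2 ^ n)%N.
  by rewrite -expnMn ltn_exp2r.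
rewrite -natrB ?(ltnW lt34) // in char.
exists (2 ^ n * 2 ^ n - 3 ^ n).-1.
rewrite (power_derivation _ e0 ee).2 prednK ?subn_gt0 // (eqP char) mul0r.
by apply: endoP => w; rewrite endo_mulE /= scale0r.
Qed.

(** From [f (x g) = f x f g = 0] follows [(x' g)^n = 0]; as [g x'] maps the image
of [c] to itself, where it would otherwise be injective, [g x' g = 0].

To remove the left factor, let [s] be [g y] and [p] be [x g] with their
[g]-[g] corner removed, up to scalars.  Then [(s - g) (s p + p g) = 0], as
[s p g = g s p].  Here [s p] lies in [g R g], where the derivation vanishes, and
what remains of the zero product [(s - g) (s p + p g)' = 0] is
[g y x' g = 0]. *)
Lemma derivation_zero_of_minimal_rank x0 : D x0 = 0.
Proof.
have [c0 _ _] := cmin.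
have [v Cv] : exists v, C v <> 0.
  by apply: contrapT => /forallNP h; apply: c0; apply: endoP => v; apply: contrapT.
have [g [b [b0 gg Dg gC [z gz]]]] := constant_scaled_idempotent.
set G := rho g in gg gC gz.
have G0 : G <> 0.
  move=> G0; apply: Cv; apply: (scalerI b0); rewrite -gC G0.
  by rewrite endo_zeroE scaler0.
have bC r : rho r * s_ b = s_ b * rho r by rewrite klin_comm.
have GXC x : G * D x * C = 0.
  have xg : (D x * G) ^+ n = 0.
    have := dn x g; rewrite DM Dg mulr0 addr0 => ->.
    by rewrite expr0n gtn_eqF // mulr0.
  apply: contrapT => h.
  have := @minimal_rank_iter (g ** d x) n v; rewrite (rngM rhoM); apply => //.
    by move=> w; exists (z (D x (C w))); rewrite endo_mulE -/G gz.
  apply: (scalerI b0); rewrite scaler0.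
  have GXn m : (G * D x) ^+ m * G = G * (D x * G) ^+ m.
    elim: m => [|m IHm]; first by rewrite !expr0 mulr1 mul1r.
    by rewrite exprS -mulrA IHm exprS !mulrA.
  rewrite (_ : b *: _ = ((G * D x) ^+ n * G) (C v)).
    by rewrite GXn xg mulr0.
  rewrite endo_mulE gC.
  have DnK : klin ((G * D x) ^+ n).
    by elim: n => [|l IHl]; [exact: klin1|rewrite exprS; apply: klinM => //;
      apply: klinM; apply: rhoK].
  by rewrite DnK.
have GXG x : G * D x * G = 0 by rewrite {2}gz mulrA GXC mul0r.
have GXA x A : G * D x * (G * A) = 0 by rewrite mulrA GXG mul0r.
have XG x : D x * G = 0.
  suff h y : G * rho y * (D x * G) = 0.
    by have [/G0|] := prime_action rhoM rhoK irr (rhoK g) h.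
  pose s := g ** g ** y - g ** y ** g; pose p := x ** g ** g - g ** x ** g.
  set X := rho x; set Y := rho y.
  have sE : rho s = G * G * Y - G * Y * G by rewrite (rngB rhoM) !rngM3.
  have pE : rho p = X * G * G - G * X * G by rewrite (rngB rhoM) !rngM3.
  have Dgzg z1 : D (g ** z1 ** g) = 0.
    by rewrite !DM Dg mul0r mulr0 addr0 add0r GXG.
  have DB u w : D (u - w) = D u - D w.
    rewrite (rho_dD rhoM dD); congr (_ + _).
    by apply/eqP; rewrite -addr_eq0 -(rho_dD rhoM dD) addNr; case: dD => dDD _;
      rewrite (_ : d 0 = 0) ?(rng0 rhoM) //; apply: (addrI (d 0));
        rewrite -dDD !addr0.
  have Ds : D s = G * G * D y.
    by rewrite DB Dgzg subr0 !DM Dg mul0r mulr0 addr0 mul0r add0r (rngM rhoM).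
  have Dp : D p = D x * G * G.
    by rewrite DB Dgzg subr0 !DM Dg !mulr0 !addr0.
  have XbE (A : endo V) r : A * rho r * s_ b = A * s_ b * rho r by rewrite
    -!mulrA bC.
  have SG : rho s * G = 0.
    by rewrite sE mulrBl -(mulrA (G * Y)) gg !mulrA !XbE bC subrr.
  have GP : G * rho p = 0.
    by rewrite pE mulrBr !mulrA gg -[_ * G * G]mulrA gg !mulrA !XbE bC subrr.
  have GS : G * rho s = s_ b * rho s by rewrite sE !mulrBr !mulrA gg.
  have PG : rho p * G = s_ b * rho p.
    by rewrite pE mulrBl -[X * G * G * G]mulrA -[G * X * G * G]mulrA gg mulrBr
      !mulrA !XbE !bC.
  have SS : rho s * rho s = 0.
    by rewrite {2}sE mulrBr !mulrA SG !mul0r subrr.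
  have [|h _] := @rule (s - g) (s ** p + p ** g).
    rewrite (rngB rhoM) (rngD rhoM) !(rngM rhoM) -/G PG mulrBl !mulrDr !mulrA.
    by rewrite SS GS !bC mul0r add0r -[_ * G * rho p]mulrA GP mulr0 addr0 subrr.
  have GGD (A : endo V) r : A * G * D r * G = 0.
    by rewrite -[A * G * _]mulrA -mulrA GXG mulr0.
  have Dsp : D (s ** p) = 0.
    rewrite DM Ds Dp sE pE mulrBr mulrBl !mulrA !GGD !mul0r !subr0.
    have := GGD G (y ** x); rewrite DM mulrDr mulrDl !mulrA.
    by move=> /(congr1 (fun A => A * G)); rewrite mulrDl mul0r.
  move: h; rewrite (rho_dD rhoM dD) Dsp add0r DM Dg mulr0 addr0 Dp (rngB rhoM) sE.
  rewrite !mulrBl !mulrA GXG GGD !mul0r !subr0 => h.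
  apply: (scalar_eq0 b0); apply: (scalar_eq0 b0); apply: (scalar_eq0 b0).
  rewrite -[RHS]h gg -[_ * G * G * G]mulrA gg !mulrA !XbE.
  by rewrite -[_ * G * G]mulrA gg !mulrA !XbE.
suff h y : D x0 * rho y * G = 0.
  by have [|/G0] := prime_action rhoM rhoK irr (rhoK (d x0)) h.
have := XG (x0 ** y); rewrite DM mulrDl -[rho x0 * _ * _]mulrA XG.
by rewrite mulr0 addr0.
Qed.

End MinimalRankElement.

Theorem derivation_zero_on_dense_module x : D x = 0.
Proof.
apply: contrapT => Dx.
have [c [k cmin]] := minimal_rank_exists Dx
  (derivation_finrank rhoM rhoK dD n_gt0 dn irr cent x).
exact/Dx/(derivation_zero_of_minimal_rank cmin).
Qed.

End DenseModules.

(** * Simple modules over rngs *)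
Definition subfield_axioms (E : pzRingType) (F : set E) : Prop :=
  [/\ subring_closed (fun x => `[< F x >]),
      forall x y, F x -> F y -> x * y = y * x, (1 : E) != 0 &
      forall x, F x -> x != 0 -> exists2 y, F y & y * x = 1].

Section Subfields.
Variables (E : pzRingType) (F : set E) (FA : subfield_axioms F).

Definition subfield_pred (_ : subfield_axioms F) : {pred E} := fun x => `[< F x >].
Local Notation Fp := (subfield_pred FA).

Fact subfield_closed : subring_closed Fp. Proof. by case: FA. Qed.
HB.instance Definition _ := GRing.isSubringClosed.Build E Fp subfield_closed.

Definition subfield_type := {x : E | x \in Fp}.
HB.instance Definition _ := SubChoice.on subfield_type.
HB.instance Definition _ := GRing.SubChoice_isSubPzRing.Build E _ subfield_type
  (GRing.subringClosedP _).

Fact subfield_mulC : commutative ( *%R : subfield_type -> _ -> _).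
Proof.
move=> [x Fx] [y Fy]; apply: val_inj; rewrite !rmorphM /=.
by case: FA => _ h _ _; apply: h; apply/asboolP.
Qed.
HB.instance Definition _ :=
  GRing.PzRing_hasCommutativeMul.Build subfield_type subfield_mulC.

Fact subfield_1neq0 : (1 : subfield_type) != 0.
Proof. by rewrite -(inj_eq val_inj) rmorph1 rmorph0; case: FA. Qed.
HB.instance Definition _ :=
  GRing.PzSemiRing_isNonZero.Build subfield_type subfield_1neq0.

Fact subfield_inv_ex (x : subfield_type) : exists y : subfield_type,
  (x != 0 -> y * x = 1) /\ (x = 0 -> y = 0).
Proof.
have [->|x0] := eqVneq x 0; first by exists 0; split=> //; rewrite eqxx.
case: x x0 => x Fx x0; have [_ _ _ h] := FA.
have [||y /asboolP Fy yx] := h x; first exact/asboolP.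
  by rewrite -(inj_eq val_inj) rmorph0 in x0.
exists (Sub y Fy : subfield_type); split=> [_|e]; last by rewrite e eqxx in x0.
by apply: val_inj; exact: yx.
Qed.

Definition subfield_inv x := projT1 (cid (subfield_inv_ex x)).
Fact subfield_mulVf x : x != 0 -> subfield_inv x * x = 1.
Proof. by have [h _] := projT2 (cid (subfield_inv_ex x)); apply: h. Qed.
Fact subfield_inv0 : subfield_inv 0 = 0.
Proof. by have [_ h] := projT2 (cid (subfield_inv_ex 0)); apply: h. Qed.
HB.instance Definition _ :=
  GRing.ComNzRing_isField.Build subfield_type subfield_mulVf subfield_inv0.

End Subfields.

Section SubfieldModule.
Variables (V : zmodType) (F : set (endo V)) (FA : subfield_axioms F).

Definition subfield_module (_ : subfield_axioms F) : Type := V.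
Local Notation VF := (subfield_module FA).
HB.instance Definition _ := GRing.Zmodule.on VF.

Definition subfield_scale (k : subfield_type FA) (v : VF) : VF := (val k : endo
  V) v.

Fact subfield_scaleA a b v :
  subfield_scale a (subfield_scale b v) = subfield_scale (a * b) v.
Proof. by rewrite /subfield_scale rmorphM. Qed.
Fact subfield_scale1 : left_id 1 subfield_scale.
Proof. by move=> v; rewrite /subfield_scale rmorph1. Qed.
Fact subfield_scaleDr : right_distributive subfield_scale +%R.
Proof. by move=> k u v; rewrite /subfield_scale endoD. Qed.
Fact subfield_scaleDl v : {morph subfield_scale^~ v : a b / a + b}.
Proof. by move=> a b; rewrite /subfield_scale rmorphD. Qed.

HB.instance Definition _ := GRing.Zmodule_isLmodule.Build (subfield_type FA) VF
  subfield_scaleA subfield_scale1 subfield_scaleDr subfield_scaleDl.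

(** The groups underlying [V] and the vector space [VF] have the same elements and
operations, but are not convertible as structures. *)
Definition endo_over (f : endo V) : endo VF := @Endo VF f (endoD f).
Definition endo_under (f : endo VF) : endo V := @Endo V f (endoD f).

Lemma endo_overM f g : endo_over (f * g) = endo_over f * endo_over g.
Proof. exact: endoP. Qed.
Lemma endo_overD f g : endo_over (f + g) = endo_over f + endo_over g.
Proof. exact: endoP. Qed.
Lemma endo_overX f m : endo_over (f ^+ m) = endo_over f ^+ m.
Proof.
elim: m => [|m IHm]; first exact: endoP.
by rewrite !exprS endo_overM IHm.
Qed.

End SubfieldModule.

Section SimpleModules.
Variables (V : zmodType) (R : rngType) (rho : R -> endo V) (z : endo V).
Hypothesis rhoM : rng_morphism rho.
Hypothesis rhoz : forall r, z * rho r = rho r * z.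

(** When not empty, these are the submodules over the polynomials in [z] with
coefficients in [R]. *)
Definition stable_subgroup (N : set V) : Prop :=
  [/\ forall u v, N u -> N v -> N (u - v), forall r v, N v -> N (rho r v) &
      forall v, N v -> N (z v)].

Hypothesis simple : forall N, stable_subgroup N ->
  (exists2 v, N v & v <> 0) -> forall w, N w.
Hypothesis nontriv : exists r v, rho r v <> 0.

Definition centralizer : set (endo V) :=
  [set f | f * z = z * f /\ forall r, f * rho r = rho r * f].

(** Schur's lemma. *)
Lemma centralizer_inv f : centralizer f -> f <> 0 ->
  exists2 g, centralizer g & g * f = 1.
Proof.
move=> [fz fr] f0.
have f_inj v : f v = 0 -> v = 0.
  move=> fv; apply: contrapT => v0; apply: f0; apply: endoP => w.
  apply: (simple (N := [set v | f v = 0]) _ _ w); last by exists v.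
  split=> [u u' fu fu'|r u fu|u fu] /=.
  - by rewrite endoB fu fu' subr0.
  - by rewrite -endo_mulE fr endo_mulE fu endo0.
  - by rewrite -endo_mulE fz endo_mulE fu endo0.
have /choice[g fg] : forall w, exists v, f v = w.
  move=> w; have [v fv] : exists v, f v <> 0.
    by apply: contrapT => /forallNP h; apply: f0; apply: endoP => v;
      apply: contrapT.
  apply: (simple (N := [set w | exists v, f v = w]) _ _ w);
    last by exists (f v) => //; exists v.
  split=> [_ _ [u <-] [u' <-]|r _ [u <-]|_ [u <-]].
  - by exists (u - u'); rewrite endoB.
  - by exists (rho r u); rewrite -!endo_mulE fr.
  - by exists (z u); rewrite -!endo_mulE fz.
have fI u v : f u = f v -> u = v.
  by move=> fuv; apply/eqP; rewrite -subr_eq0; apply/eqP/f_inj;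
    rewrite endoB fuv subrr.
have gD u v : g (u + v) = g u + g v by apply: fI; rewrite endoD !fg.
exists (Endo gD); last by apply: endoP => v; apply: fI; rewrite endo_mulE /= fg.
split=> [|r]; apply: endoP => v; apply: fI; rewrite !endo_mulE /= fg.
  by rewrite -endo_mulE fz endo_mulE fg.
by rewrite -[f _]endo_mulE fr endo_mulE fg.
Qed.

(** By Zorn's lemma.  With Schur's lemma, [F] becomes the field of scalars, and the
last property is the hypothesis [scalar_centralizer] of the density theorem. *)
Lemma maximal_commutative : exists F : set (endo V),
  [/\ F `<=` centralizer, forall f g, F f -> F g -> f * g = g * f &
      forall f, centralizer f -> (forall g, F g -> f * g = g * f) -> F f].
Proof.
pose P (F : set (endo V)) := F `<=` centralizer /\
  forall f g, F f -> F g -> f * g = g * f.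
have [|F [[FC Fcomm] Fmax]] := @Zorn_bigcup _ P.
  move=> Fam FamP tot; split=> [f [F FamF Ff]|f g [F FamF Ff] [G FamG Gg]].
    by case: (FamP _ FamF) => h _; apply: h.
  have [FG|GF] := tot _ _ FamF FamG.
    by case: (FamP _ FamG) => _; apply=> //; apply: FG.
  by case: (FamP _ FamF) => _; apply=> //; apply: GF.
exists F; split=> // f fC fF; apply: contrapT => Ff.
apply: (Fmax (F `|` [set f])).
  by split=> [g Fg|h]; [left|apply/Ff/h; right].
split=> [g [/FC//|->//]|g h [Fg|->] [Fh|->]] //; first exact: Fcomm.
  by rewrite fF.
exact: fF.
Qed.

Variables (d : R -> R) (n : nat).
Hypotheses (dD : derivation rmul d) (n_gt0 : (0 < n)%N).
Hypothesis dn : forall x y,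
  rho (d (x ** y)) ^+ n = rho (d x) ^+ n * rho (d y) ^+ n.

Theorem derivation_zero_on_simple_module x : rho (d x) = 0.
Proof.
have [F [FC Fcomm Fmax]] := maximal_commutative.
have z0 : (1 : endo V) != 0.
  have [r [v rv]] := nontriv; apply/eqP => h; apply: rv.
  by rewrite -[rho r]mulr1 h mulr0.
have FA : subfield_axioms F.
  split=> //.
  - split=> [|f g /asboolP Ff /asboolP Fg|f g /asboolP Ff /asboolP Fg];
      apply/asboolP; apply: Fmax.
    + by split=> [|r]; rewrite mul1r mulr1.
    + by move=> g _; rewrite mul1r mulr1.
    + have [fz fr] := FC _ Ff; have [gz gr] := FC _ Fg.
      by split=> [|r]; rewrite mulrBl mulrBr ?fz ?gz ?fr ?gr.
    + by move=> h Fh; rewrite mulrBl mulrBr (Fcomm f h) // (Fcomm g h).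
    + have [fz fr] := FC _ Ff; have [gz gr] := FC _ Fg.
      by split=> [|r]; rewrite -mulrA ?gz ?gr mulrA ?fz ?fr mulrA.
    + by move=> h Fh; rewrite -mulrA (Fcomm g h) // mulrA (Fcomm f h) // mulrA.
  - move=> f Ff /eqP f0; have [g gC gf] := centralizer_inv (FC _ Ff) f0.
    exists g => //; apply: Fmax => // h Fh.
    have fg : f * g = 1.
      have g0 : g <> 0 by move=> g0; move: gf z0; rewrite g0 mul0r => ->;
        rewrite eqxx.
      have [g' _ g'g] := centralizer_inv gC g0.
      by rewrite -[f * g]mul1r -{1}g'g -mulrA [g * (f * g)]mulrA gf mul1r g'g.
    by rewrite -[g * h]mulr1 -fg mulrA -[g * h * f]mulrA -(Fcomm f h) // mulrA
      gf mul1r.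
have zF : F z by apply: Fmax => [|g /FC[]]; [split|].
pose W : lmodType (subfield_type FA) := subfield_module FA.
pose rhoW r : endo W := endo_over FA (rho r).
have FE (k : subfield_type FA) : F (val k) by apply/asboolP; exact: (valP k).
have Fp f : F f -> f \in subfield_pred FA by move=> Ff; apply/asboolP.
suff Dx : rhoW (d x) = 0.
  by apply: endoP => v; exact: (congr1 (fun f : endo W => f v) Dx).
apply: (@derivation_zero_on_dense_module _ W R rhoW d n) => //.
- by split=> u v; rewrite /rhoW ?(rngD rhoM) ?(rngM rhoM) ?endo_overD ?endo_overM.
- move=> r k v; have [_ kr] := FC _ (FE k).
  exact: (esym (congr1 (fun f : endo V => f v) (kr r))).
- by move=> u v; rewrite /rhoW -!endo_overX dn endo_overM.
- split; first by have [r [v rv]] := nontriv; exists r, v.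
  move=> N [N0 ND NZ Nr]; apply: simple; split=> //.
    move=> u v Nu Nv; have := ND u _ Nu (NZ (-1) _ Nv).
    by rewrite scaleN1r.
  move=> v Nv; exact: (NZ (Sub z (Fp _ zF) : subfield_type FA) v Nv).
- move=> T TK Tr; pose T' := endo_under T.
  have TF : F T'.
    apply: Fmax => [|g Fg].
      split=> [|r]; apply: endoP => v.
        exact: (TK (Sub z (Fp _ zF) : subfield_type FA) v).
      exact: (congr1 (fun f : endo W => f v) (Tr r)).
    by apply: endoP => v; exact: (TK (Sub g (Fp _ Fg) : subfield_type FA) v).
  by exists (Sub T' (Fp _ TF) : subfield_type FA); apply: endoP => v.
Qed.

End SimpleModules.

(** * A simple module for a non-nilpotent element *)
Section Unitization.
Variable R : rngType.

Lemma additive_mulz (U W : zmodType) (f : U -> W) :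
  (forall x y, f (x + y) = f x + f y) -> forall m x, f (x *~ m) = f x *~ m.
Proof.
move=> fD; have f0 : f 0 = 0 by apply: (addrI (f 0)); rewrite -fD !addr0.
have fN x : f (- x) = - f x by apply: (addrI (f x)); rewrite -fD !subrr.
have fM k x : f (x *+ k) = f x *+ k.
  by elim: k => [|k IHk]; rewrite ?mulr0n // !mulrS fD IHk.
by case=> k x; rewrite -?pmulrn ?NegzE ?mulrNz ?fN -?pmulrn fM.
Qed.

Lemma rmul_mulzl (x y : R) m : (x *~ m) ** y = (x ** y) *~ m.
Proof. by apply: (@additive_mulz _ _ (rmul^~ y)) => u v; rewrite rmulDl. Qed.
Lemma rmul_mulzr (x y : R) m : x ** (y *~ m) = (x ** y) *~ m.
Proof. by apply: (@additive_mulz _ _ (rmul x)) => u v; rewrite rmulDr. Qed.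
Lemma rmul0l (x : R) : 0 ** x = 0.
Proof. by apply: (addrI (0 ** x)); rewrite -rmulDl !addr0. Qed.
Lemma rmul0r (x : R) : x ** 0 = 0.
Proof. by apply: (addrI (x ** 0)); rewrite -rmulDr !addr0. Qed.

Definition unitization : Type := (int * R)%type.
HB.instance Definition _ := GRing.Zmodule.on unitization.

Definition unitization_mul (a b : unitization) : unitization :=
  (a.1 * b.1, b.2 *~ a.1 + a.2 *~ b.1 + a.2 ** b.2).

Fact unitization_mulA : associative unitization_mul.
Proof.
move=> [m r] [n s] [p t]; rewrite /unitization_mul /=; congr (_, _).
  by rewrite mulrA.
rewrite !mulrzDl !rmulDl !rmulDr !rmul_mulzl !rmul_mulzr -!mulrzA rmulA.
by rewrite [n * m]mulrC [p * m]mulrC [n * p]mulrC [LHS](AC (4*3)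
  ((1*(2*4*6))*(3*5*7))) [p * n]mulrC.
Qed.
Fact unitization_mul1 : left_id ((1, 0) : unitization) unitization_mul.
Proof.
move=> [m r]; rewrite /unitization_mul /= mul1r mulr1z mul0rz addr0 rmul0l.
by rewrite addr0.
Qed.
Fact unitization_mulr1 : right_id ((1, 0) : unitization) unitization_mul.
Proof.
move=> [m r]; rewrite /unitization_mul /= mulr1 mulr1z mul0rz add0r rmul0r.
by rewrite addr0.
Qed.
Fact unitization_mulDl : left_distributive unitization_mul +%R.
Proof.
move=> [m r] [n s] [p t]; rewrite /unitization_mul /=; congr (_, _) => /=.
  by rewrite mulrDl.
by rewrite rmulDl mulrzDr mulrzDl; rewrite [LHS](AC ((2*2)*2) ((1*3*5)*(2*4*6))).
Qed.
Fact unitization_mulDr : right_distributive unitization_mul +%R.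
Proof.
move=> [m r] [n s] [p t]; rewrite /unitization_mul /=; congr (_, _) => /=.
  by rewrite mulrDr.
by rewrite rmulDr mulrzDr mulrzDl [LHS](AC ((2*2)*2) ((1*3*5)*(2*4*6))).
Qed.
Fact unitization_1neq0 : ((1, 0) : unitization) != 0.
Proof. by []. Qed.

HB.instance Definition _ := GRing.Zmodule_isNzRing.Build unitization
  unitization_mulA unitization_mul1 unitization_mulr1 unitization_mulDl
  unitization_mulDr unitization_1neq0.

Definition unitization_in (r : R) : unitization := (0, r).

Lemma unitization_rng_morphism : rng_morphism unitization_in.
Proof.
split=> r s; rewrite /unitization_in.
  by congr (_, _); rewrite addr0.
change ((0, r ** s) = unitization_mul (0, r) (0, s)).
by rewrite /unitization_mul /= mulr0 !mulr0z !add0r.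
Qed.

Lemma unitizationE (a : unitization) :
  a = a.1%:~R + unitization_in a.2.
Proof.
case: a => m r /=.
suff -> : (m%:~R : unitization) = (m, 0) by congr (_, _); rewrite /= ?addr0 ?add0r.
have e1 := @additive_mulz unitization int fst (fun _ _ => erefl) m 1.
have e2 := @additive_mulz unitization R snd (fun _ _ => erefl) m 1.
by rewrite [LHS]surjective_pairing e1 e2 /= mul0rz intz.
Qed.

End Unitization.

Section LeftIdeals.
Variable A : pzRingType.
Implicit Types L M : set A.

Definition left_ideal L : Prop :=
  [/\ L 0, forall x y, L x -> L y -> L (x - y) & forall a x, L x -> L (a * x)].

Definition maximal_left_ideal L : Prop :=
  [/\ left_ideal L, ~ L 1 & forall M, left_ideal M -> L `<=` M -> ~ M 1 -> M
    `<=` L].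

Lemma maximal_left_ideal_exists L0 : left_ideal L0 -> ~ L0 1 ->
  exists2 L, maximal_left_ideal L & L0 `<=` L.
Proof.
move=> L0I L01.
pose P L := L = set0 \/ [/\ left_ideal L, L0 `<=` L & ~ L 1].
have [|L [PL Lmax]] := @Zorn_bigcup _ P.
  move=> Fam FamP tot.
  have [[F0 FamF0 [x0 F0x0]]|Fam0] := pselect (exists2 F, Fam F & F !=set0);
    last first.
    left; apply/seteqP; split=> // x [F FamF Fx]; apply: Fam0.
    by exists F => //; exists x.
  have good F : Fam F -> F !=set0 -> [/\ left_ideal F, L0 `<=` F & ~ F 1].
    by move=> /FamP[->[]//|].
  have [[F00 _ _] L0F0 _] := good F0 FamF0 (ex_intro _ x0 F0x0).
  right; split; last 2 first.
  - by move=> x /L0F0 F0x; exists F0.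
  - by move=> [F FamF F1]; have [_ _] := good F FamF (ex_intro _ 1 F1); apply.
  split; first by exists F0.
    move=> x y [F FamF Fx] [G FamG Gy].
    have [[_ FB _] _ _] := good F FamF (ex_intro _ x Fx).
    have [[_ GB _] _ _] := good G FamG (ex_intro _ y Gy).
    have [FG|GF] := tot _ _ FamF FamG.
      by exists G => //; apply: GB => //; apply: FG.
    by exists F => //; apply: FB => //; apply: GF.
  move=> a x [F FamF Fx]; have [[_ _ FM] _ _] := good F FamF (ex_intro _ x Fx).
  by exists F => //; apply: FM.
have [LE|[LI L0L L1]] := PL.
  exfalso; apply: (Lmax L0); last by right; split.
  by rewrite LE; split=> // h; have [L00 _ _] := L0I; apply: (h 0 L00).
exists L => //; split=> // M MI LM M1; apply: contrapT => ML.
by apply: (Lmax M); [split|right; split=> // x /L0L/LM].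
Qed.

End LeftIdeals.

Section CyclicModules.
Local Open Scope quotient_scope.
Variables (A : pzRingType) (L : set A) (LI : left_ideal L).

(** The proof is an argument in order that the closure properties be found by
inference from the predicate. *)
Definition left_ideal_pred (_ : left_ideal L) : {pred A} := fun x => `[< L x >].
Local Notation Lp := (left_ideal_pred LI).

Fact left_ideal_closed : zmod_closed Lp.
Proof.
have [L0 LB _] := LI; split; first exact/asboolP.
by move=> x y /asboolP Lx /asboolP Ly; apply/asboolP/LB.
Qed.
HB.instance Definition _ := GRing.isZmodClosed.Build A Lp left_ideal_closed.

Definition cyclic_module := Quotient.quot Lp.
HB.instance Definition _ := GRing.Zmodule.on cyclic_module.
HB.instance Definition _ := EqQuotient.on cyclic_module.

Definition coset_of_left_ideal (x : A) : cyclic_module := \pi_(Quotient.quot Lp) x.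
Local Notation pi_ := coset_of_left_ideal.

Lemma cosetB x y : pi_ (x - y) = pi_ x - pi_ y.
Proof. by rewrite /coset_of_left_ideal raddfB. Qed.

Lemma coset_eq0 x : pi_ x = 0 <-> L x.
Proof.
split=> [x0|Lx].
  have /eqP : \pi_(Quotient.quot Lp) x = \pi_(Quotient.quot Lp) 0.
    by rewrite raddf0; exact: x0.
  by rewrite -Quotient.idealrBE subr0 => /asboolP.
rewrite -[RHS](_ : \pi_(Quotient.quot Lp) 0 = 0); last by rewrite raddf0.
by apply/eqP; rewrite -Quotient.idealrBE subr0; apply/asboolP.
Qed.

Lemma cosetD x y : pi_ (x + y) = pi_ x + pi_ y.
Proof. by rewrite /coset_of_left_ideal raddfD. Qed.

Lemma coset_surj v : exists x, v = pi_ x.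
Proof. by exists (repr v); rewrite /coset_of_left_ideal reprK. Qed.

Definition left_mul (a : A) (v : cyclic_module) := pi_ (a * repr v).

Lemma left_mulE a x : left_mul a (pi_ x) = pi_ (a * x).
Proof.
apply/eqP; rewrite -subr_eq0 -cosetB -mulrBr; apply/eqP/coset_eq0.
have [_ _ LM] := LI; apply: LM; apply/coset_eq0.
by rewrite cosetB /coset_of_left_ideal reprK subrr.
Qed.

Fact left_mulD a u v : left_mul a (u + v) = left_mul a u + left_mul a v.
Proof.
have [x ->] := coset_surj u; have [y ->] := coset_surj v.
by rewrite -cosetD !left_mulE mulrDr cosetD.
Qed.

Definition cyclic_action (a : A) : endo cyclic_module := Endo (left_mulD a).

Lemma cyclic_actionE a x : cyclic_action a (pi_ x) = pi_ (a * x).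
Proof. exact: left_mulE. Qed.

Lemma cyclic_actionD a b : cyclic_action (a + b) = cyclic_action a +
  cyclic_action b.
Proof.
apply: endoP => v; have [x ->] := coset_surj v.
by rewrite endo_addE !cyclic_actionE mulrDl cosetD.
Qed.

Lemma cyclic_actionM a b : cyclic_action (a * b) = cyclic_action a *
  cyclic_action b.
Proof.
apply: endoP => v; have [x ->] := coset_surj v.
by rewrite endo_mulE !cyclic_actionE mulrA.
Qed.

Lemma cyclic_action1 : cyclic_action 1 = 1.
Proof.
by apply: endoP => v; have [x ->] := coset_surj v; rewrite cyclic_actionE mul1r.
Qed.

End CyclicModules.

Lemma coset1_neq0 (A : pzRingType) (L : set A) (LI : left_ideal L) :
  ~ L 1 -> coset_of_left_ideal LI 1 <> 0.
Proof. by move=> L1 /coset_eq0. Qed.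

Lemma maximal_left_ideal_simple (A : pzRingType) (L : set A) (LI : left_ideal L)
    (N : set (cyclic_module LI)) :
  maximal_left_ideal L ->
  (forall u v, N u -> N v -> N (u - v)) ->
  (forall a v, N v -> N (cyclic_action LI a v)) ->
  (exists2 v, N v & v <> 0) -> forall w, N w.
Proof.
move=> [_ L1 Lmax] NB NA [v Nv v0] w.
pose M : set A := [set x | N (coset_of_left_ideal LI x)].
have N0 : N 0 by rewrite -(subrr v); apply: NB.
have MI : left_ideal M.
  split=> [|x y|a x]; rewrite /M /=.
  - by rewrite (coset_eq0 LI 0).2 //; have [] := LI.
  - by rewrite cosetB; apply: NB.
  - by move=> Nx; rewrite -cyclic_actionE; apply: NA.
have LM : L `<=` M by move=> x Lx; rewrite /M /= (coset_eq0 LI x).2.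
have M1 : M 1.
  apply: contrapT => M1; have [x vx] := coset_surj v.
  apply: v0; rewrite vx; apply/coset_eq0; apply: (Lmax M MI LM M1).
  by rewrite /M /= -vx.
have [x ->] := coset_surj w; rewrite -[x]mulr1 -cyclic_actionE.
exact: NA.
Qed.

Section NonNilpotentElements.
Variables (S : rngType) (b : S).
Hypothesis b_nnil : forall i, rpow b i.+1 <> 0.

Local Notation A := {poly unitization S}.
Let ins (s : S) : unitization S := unitization_in s.
Let insM := unitization_rng_morphism S.

Lemma one_sub_bX_left_ideal : left_ideal [set p * (1 - (ins b)%:P * 'X) | p in
  @setT A].
Proof.
split.
- by exists 0 => //; rewrite mul0r.
- by move=> _ _ [p _ <-] [q _ <-]; exists (p - q) => //; rewrite mulrBl.
- by move=> a _ [p _ <-]; exists (a * p) => //; rewrite mulrA.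
Qed.

(** A left inverse of [1 - b X] would be the geometric series, which does not
stop. *)
Lemma one_sub_bX_proper : ~ [set p * (1 - (ins b)%:P * 'X) | p in @setT A] 1.
Proof.
move=> [p _ p1].
have coef i : p`_i = ins b ^+ i.
  have pE : p = 1 + p * (ins b)%:P * 'X.
    by rewrite -p1 mulrBr mulr1 mulrA subrK.
  elim: i => [|i IHi]; rewrite pE coefD coef1 coefMX /= ?addr0 ?expr0 //.
  by rewrite add0r coefMC IHi exprSr.
have : ins b ^+ (size p).+1 = 0.
  by rewrite -coef nth_default.
rewrite -(rng_pow insM) // => -[]; exact: b_nnil.
Qed.

(** In the quotient by a maximal left ideal containing [1 - b X], the class of [1]
is fixed by [b X]. *)
Lemma simple_module_exists : exists (V : zmodType) (rho : S -> endo V) (z : endo V),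
  [/\ rng_morphism rho, forall r, z * rho r = rho r * z,
      forall N, stable_subgroup rho z N -> (exists2 v, N v & v <> 0) -> forall
        w, N w
    & rho b <> 0].
Proof.
have [L Lmax L0] := maximal_left_ideal_exists one_sub_bX_left_ideal
  one_sub_bX_proper.
have [LI L1 _] := Lmax.
pose act := cyclic_action LI.
exists (cyclic_module LI), (fun s => act (ins s)%:P), (act 'X).
have actD a c : act (a + c) = act a + act c by apply: cyclic_actionD.
have actM a c : act (a * c) = act a * act c by apply: cyclic_actionM.
split.
- split=> x y; first by rewrite /ins (rngD insM) polyCD actD.
  by rewrite /ins (rngM insM) polyCM actM.
- by move=> r; rewrite -!actM commr_polyX.
- move=> N [NB Nr NX]; apply: (maximal_left_ideal_simple Lmax) => //.
  have N0 v : N v -> N 0 by move=> Nv; rewrite -(subrr v); apply: NB.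
  have NN v : N v -> N (- v).
    by move=> Nv; rewrite -sub0r; apply: NB => //; apply: N0 Nv.
  have ND u v : N u -> N v -> N (u + v).
    by move=> Nu Nv; rewrite -[v]opprK; apply/NB/NN.
  have Nz m v : N v -> N (v *~ m).
    move=> Nv; have Nn k : N (v *+ k).
      by elim: k => [|k IHk]; rewrite ?mulr0n ?mulrS; [apply: N0 Nv|apply: ND].
    by case: m => k; rewrite ?NegzE ?mulrNz -pmulrn; [|apply: NN].
  elim/poly_ind => [|p c IHp] v Nv.
    have -> : act 0 v = 0.
      have := actD 0 0; rewrite addr0 => /(congr1 (fun f => f - act 0)).
      by rewrite addrK subrr => <-.
    exact: N0 Nv.
  rewrite -[cyclic_action LI]/act actD actM endo_addE endo_mulE.
  apply: (ND); first by apply: IHp; apply: NX.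
  rewrite (unitizationE c) polyCD actD endo_addE; apply: ND; last exact: Nr.
  have -> : act (c.1%:~R)%:P v = v *~ c.1.
    have -> : (c.1%:~R)%:P = 1 *~ c.1 :> A by rewrite rmorph_int.
    rewrite (@additive_mulz _ _ (fun a => act a v)) ?/act ?cyclic_action1 //.
    by move=> x y; rewrite cyclic_actionD.
  exact: Nz.
- move=> b0; have := @coset1_neq0 _ L LI L1; apply.
  have : act (ins b)%:P (act 'X (coset_of_left_ideal LI 1)) = 0.
    by rewrite b0 endo_zeroE.
  rewrite /act !cyclic_actionE mulr1 => bX; rewrite -bX.
  apply/eqP; rewrite -subr_eq0 -cosetB; apply/eqP/coset_eq0/L0.
  by exists 1 => //; rewrite mul1r.
Qed.

End NonNilpotentElements.

(** * Vanishing of the derivation *)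
Section Sequences.
Variable R : rngType.

Definition seq_rng : Type := nat -> R.
HB.instance Definition _ := GRing.Zmodule.on seq_rng.

Definition seq_rmul (x y : seq_rng) : seq_rng := fun k => x k ** y k.
Fact seq_rmulA : associative seq_rmul.
Proof. by move=> x y w; apply/funext => k; apply: rmulA. Qed.
Fact seq_rmulDl : left_distributive seq_rmul +%R.
Proof. by move=> x y w; apply/funext => k; apply: rmulDl. Qed.
Fact seq_rmulDr : right_distributive seq_rmul +%R.
Proof. by move=> x y w; apply/funext => k; apply: rmulDr. Qed.
HB.instance Definition _ :=
  Zmodule_isRng.Build seq_rng seq_rmulA seq_rmulDl seq_rmulDr.

Lemma seq_rpow (x : seq_rng) m k : rpow x m k = rpow (x k) m.
Proof.
case: m => // m; elim: m => // m IHm.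
by rewrite !rpowS -IHm.
Qed.

End Sequences.

(** Sequences are used because [R a] may be nil without bound on the indices; the
sequence of the [r_k a] with [(r_k a)^(k+1) <> 0] is not nilpotent, and the
power condition holds for sequences coordinatewise. *)
Theorem power_multiplicative_derivation_zero (R : rngType) (d : R -> R) (n : nat) :
  semiprime R -> derivation rmul d -> (1 <= n)%N ->
  (forall x y, rpow (d (x ** y)) n = rpow (d x) n ** rpow (d y) n) ->
  forall x, d x = 0.
Proof.
move=> hR [dD dM] n_gt0 dn x0; apply: contrapT => a0; set a := d x0 in a0.
have /choice[r rP] : forall k : nat, exists r, rpow (r ** a) k.+1 <> 0.
  move=> k; apply: contrapT => /forallNP h; apply: a0.
  have insM := unitization_rng_morphism R.
  have ins_inj u : unitization_in u = 0 -> u = 0 by case.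
  apply: (ins_inj); apply: (levitzki insM _ (m := k.+1)) => [u hu|u].
    rewrite (hR u) ?(rng0 insM) // => y.
    by apply: ins_inj; rewrite !(rngM insM).
  have := h u => /contrapT hu.
  have comm m : (unitization_in a * unitization_in u) ^+ m * unitization_in a =
     unitization_in a * (unitization_in u * unitization_in a) ^+ m.
    elim: m => [|m IHm]; first by rewrite !expr0 mulr1 mul1r.
    by rewrite exprS -mulrA IHm exprS !mulrA.
  by rewrite comm -(rngM insM) -(rng_pow insM) // hu (rng0 insM) mulr0.
pose S := seq_rng R; pose b : S := fun k => r k ** a.
have b_nnil i : rpow b i.+1 <> 0.
  by move=> /(congr1 (fun f => f i)); rewrite seq_rpow; apply: rP.
have [V [rho [z [rhoM rhoz simple rhob]]]] := simple_module_exists b_nnil.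
pose dS (f : S) : S := fun k => d (f k).
have dSD : derivation rmul dS.
  by split=> f g; apply/funext => k; [apply: dD|apply: dM].
have dSn f g : rho (dS (f ** g)) ^+ n = rho (dS f) ^+ n * rho (dS g) ^+ n.
  rewrite -!(rng_pow rhoM) // -(rngM rhoM); congr rho; apply/funext => k.
  change (rpow (dS (f ** g)) n k = rpow (dS f) n k ** rpow (dS g) n k).
  by rewrite !seq_rpow; apply: dn.
have nontriv : exists s v, rho s v <> 0.
  exists b; apply: contrapT => /forallNP h; apply: rhob; apply: endoP => v.
  exact: contrapT.
have := derivation_zero_on_simple_module rhoM rhoz simple nontriv dSD n_gt0 dSn.
move=> /(_ (fun=> x0)) rho0; apply: rhob.
have -> : b = (r : seq_rng R) ** dS (fun=> x0) by [].
by rewrite (rngM rhoM) rho0 mulr0.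
Qed.

Theorem theorem1p3 (R : rngType) (hR : semiprime R)
  (d : R -> R) (hd : derivation rmul d)
  (n : nat) (hn : (1 <= n)%N)
  (hdn : forall x y : R, rpow (d (x ** y)) n = rpow (d x) n ** rpow (d y) n)
  (Q : pzRingType) (iota : R -> Q) (hQ : symmetric_martindale_quotient iota)
  (delta : Q -> Q) (hdelta : derivation *%R delta)
  (hext : forall x : R, delta (iota x) = iota (d x)) :
  let A := orthogonal_completion iota in
  exists e : Q,
    [/\ central_idempotents e,
        (forall x y : Q, [set e * a | a in A] x -> [set e * a | a in A] y ->
           x * y = y * x)
      & (forall x : Q, [set (1 - e) * a | a in A] x -> delta x = 0)].
Proof.
have d0 := power_multiplicative_derivation_zero hR hd hn hdn.
have delta_iota x : delta (iota x) = 0.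
  rewrite hext d0; apply: (addrI (iota 0)).
  by rewrite -(smq_add hQ) !addr0.
have delta0 q : delta q = 0.
  have [J Jd Jq] := smq_fraction hQ q; apply: (smq_faithful hQ Jd); left=> x Jx.
  have [[y _ yE] _] := Jq x Jx.
  have := delta_iota y; rewrite yE hdelta.2 delta_iota mulr0 addr0.
  by [].
exists 0; split=> [|x y [a _ <-] [b _ <-]|x _]; rewrite ?mul0r //.
by split; rewrite ?mul0r // => q; rewrite mul0r mulr0.
Qed.
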